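(* For every real $\rho>1/2$ and every real $y>0$, $$2^{\rho-1}\,\Gamma(\rho)\int_y^\infty \frac{e^{-x} I_{\rho-1}(x)}{x^{\rho}}\,dx = -\gamma + y\cdot {}_3F_3\left(\begin{array}{c} 1,\,1,\,\rho+\frac12\\ 2,\,2,\,2\rho\end{array};\,-2y\right)-\log(2y)+\psi(2\rho-1)-\psi\left(\rho-\tfrac12\right).$$
   Context: $I_\nu$ denotes the modified Bessel function of the first kind of order $\nu$, $I_\nu(t) := \sum_{k=0}^{\infty} \frac{(t/2)^{2k+\nu}}{k!\,\Gamma(k+1+\nu)}$. $\psi(z):=\Gamma'(z)/\Gamma(z)$ for $\Re z>0$ is the digamma function, and $\gamma:=-\psi(1)$ is the Euler--Mascheroni constant. ${}_3F_3$ is the generalized hypergeometric function $${}_3F_3\left(\begin{array}{c} a_1,a_2,a_3\\ b_1,b_2,b_3\end{array};z\right)=\sum_{\ell=0}^\infty \frac{(a_1)_\ell (a_2)_\ell (a_3)_\ell}{(b_1)_\ell (b_2)_\ell (b_3)_\ell}\,\frac{z^\ell}{\ell!},$$ where $(a)_\ell=\Gamma(a+\ell)/\Gamma(a)$ is the Pochhammer symbol; the series converges for all complex $z$. *)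

(* Defs.v *)
From HB Require Import structures.
From mathcomp Require Import all_boot all_order all_algebra.
From mathcomp Require Import all_classical all_reals all_analysis.

Set Implicit Arguments.
Unset Strict Implicit.
Unset Printing Implicit Defensive.

Import Order.TTheory GRing.Theory Num.Theory.
Import numFieldNormedType.Exports.

Local Open Scope classical_set_scope.
Local Open Scope ring_scope.

(* Euler's integral, hence the Gamma function for x > 0 only; for x <= 0 the
   integral is +oo and the value is the default 0. *)
Definition Gamma {R : realType} (x : R) : R :=
  fine (\int[lebesgue_measure]_(t in `]0%R, +oo[) (t `^ (x - 1) * expR (- t))%:E).

Definition digamma {R : realType} (x : R) : R := derive1 Gamma x / Gamma x.

Definition euler_mascheroni {R : realType} : R := - digamma 1.

(* Meaningful for nu > -1, where every k + 1 + nu is positive, and t > 0,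
   as the powers are real. *)
Definition besselI {R : realType} (nu t : R) : R :=
  limn (series (fun k : nat =>
    (t / 2) `^ (2 * k%:R + nu) / (k`!%:R * Gamma (k%:R + 1 + nu)))).

(* Meaningful for a > 0, as it is a quotient of values of Gamma. *)
Definition pochhammer {R : realType} (a : R) (l : nat) : R :=
  Gamma (a + l%:R) / Gamma a.

Definition hypergeometric3F3 {R : realType} (a1 a2 a3 b1 b2 b3 z : R) : R :=
  limn (series (fun l : nat =>
    (pochhammer a1 l * pochhammer a2 l * pochhammer a3 l) /
    (pochhammer b1 l * pochhammer b2 l * pochhammer b3 l) *
    (z ^+ l / l`!%:R))).

(* Main.v *)
(** Put [a = rho - 1/2] and let [B] have the Beta(a, a) law, realised as [B = 1 / (1 + u)] with [u] distributed on the half-line with density proportional to [u^(a-1) (1+u)^(-2a)]; then scaling and Tonelli suffice to compute its moments as quotients of Gamma values.  Kummer's second formula turns the integrand of the left-hand side into [E exp(-2 x B) / x]: expanding [exp(-x) exp(x (1 - 2B))], the odd moments of [1 - 2B] vanish and the even ones are the coefficients of the Bessel series.  By Tonelli the left-hand side is therefore [E (int_y^oo exp(-2 B x) / x dx)].  For fixed [c > 0], splitting [int_0^oo c exp(-c t) (ln t - ln y) dt = - gamma - ln c - ln y] at [t = y] and writing [ln t - ln y] as an integral of [1/x] gives [int_y^oo exp(-c x) / x dx = int_0^y (1 - exp(-c x)) / x dx - gamma - ln c - ln y].  With [c = 2B], the expectation of the power series of the first term is [y] times the hypergeometric series, and [E ln B = psi(a) - psi(2a)] is a logarithmic derivative of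 the beta function.

Every derivative needed (differentiability of Gamma, [Gamma' (1)], [E ln B], and even [Gamma (s + 1) = s Gamma s], obtained by differentiating [int t^(s-1) exp(-c t) dt = c^(-s) Gamma s] in [c]) is an instance of a single differentiation under the integral of [w b^s] with respect to [s]. *)

Require Import Defs.
From HB Require Import structures.
From mathcomp Require Import all_boot all_order all_algebra.
From mathcomp Require Import all_classical all_reals all_analysis.
From mathcomp Require Import measurable_realfun.
From mathcomp Require Import ring lra.

Set Implicit Arguments.
Unset Strict Implicit.
Unset Printing Implicit Defensive.

Import Order.TTheory GRing.Theory Num.Theory.
Import numFieldNormedType.Exports.

Local Open Scope classical_set_scope.
Local Open Scope ring_scope.

Local Notation mu := lebesgue_measure.

(** * Integration lemmas *)

(** Lebesgue measure equals [c] times its pushforward under multiplication by [c], since both give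
    []a, b]] the same mass; the rest is the change of variables for a pushforward. *)
Lemma ge0_integral_scale (R : realType) (c : R) (f : R -> R) : 0 < c ->
  measurable_fun (`]0%R, +oo[ : set R) f -> (forall x : R, 0 < x -> 0 <= f x) ->
  (\int[mu]_(x in `]0%R, +oo[) (f x)%:E =
   c%:E * \int[mu]_(x in `]0%R, +oo[) (f (c * x))%:E)%E.
Proof.
move=> c0 mf f0.
pose phi : measurableTypeR R -> measurableTypeR R := *%R c.
have mphi : measurable_fun setT phi.
  by apply: measurable_funM; [exact: measurable_cst|exact: measurable_id].
pose m : {measure set (measurableTypeR R) -> \bar R} :=
  mscale (NngNum (ltW c0))
  (measure_function_pushforward__canonical__measure_function_Measure
    (@lebesgue_measure R) mphi).
have mE (A : set R) : measurable A -> lebesgue_measure A = m A.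
  apply: lebesgue_measure_unique => _ [[a b]] _ <-.
  rewrite /m/= /mscale/= /pushforward.
  have -> : phi @^-1` `]a, b] = `]a / c, b / c]%classic.
    apply/seteqP; split => x /=; rewrite !in_itv/= /phi.
      by move=> h; rewrite ltr_pdivrMr// ler_pdivlMr// ![x * _]mulrC.
    by rewrite ltr_pdivrMr// ler_pdivlMr// ![x * _]mulrC.
  rewrite !lebesgue_measure_itv/= !lte_fin ltr_pM2r ?invr_gt0//.
  case: ifPn => _; last by rewrite mule0.
  by rewrite -!EFinB -EFinM; congr EFin; field; rewrite gt_eqF.
have pre : phi @^-1` `]0, +oo[ = `]0, +oo[%classic.
  by apply/seteqP; split => x /=; rewrite !in_itv/= !andbT /phi pmulr_rgt0.
have mf' : measurable_fun (`]0%R, +oo[ : set (measurableTypeR R)) (EFin \o f).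
  exact/measurable_EFinP.
have f0' : {in `]0%R, +oo[%classic, forall y : R, (0%E <= (EFin \o f) y)%E}.
  by move=> x; rewrite inE/= in_itv/= andbT lee_fin => /f0.
rewrite -[X in (_ = _ * integral _ X _)%E]pre.
rewrite -(@ge0_integral_pushforward _ _ _ _ _ phi mphi _ _ _ _ mf')//.
rewrite -[c%:E]/((NngNum (ltW c0))%:num%:E).
rewrite -ge0_integral_mscale//.
  by apply: eq_measure_integral => //= A mA AS; exact: mE.
by move=> x /mem_set /f0'.
Qed.

(** On the interval from [1/(n+1)] to [n+1] the fundamental theorem of calculus bounds the integral
    by [M + M], and monotone convergence carries this bound to the half-line. *)
Lemma ge0_integrable_bounded_primitive (R : realType) (f F : R -> R) (M : R) :
  (forall x : R, 0 < x -> 0 <= f x) -> (forall x : R, 0 < x -> {for x, continuous f}) ->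
  (forall x : R, 0 < x -> is_derive x 1 F (f x)) -> (forall x : R, 0 < x -> `|F x| <= M) ->
  (@lebesgue_measure R).-integrable `]0, +oo[ (EFin \o f).
Proof.
move=> f0 cf dF FM.
have mf : measurable_fun (`]0%R, +oo[ : set R) f.
  apply: open_continuous_measurable_fun => // x.
  by rewrite inE/= in_itv/= andbT; exact: cf.
apply/integrableP; split; first exact/measurable_EFinP.
pose A (n : nat) : set R := `[(n.+1%:R)^-1, n.+1%:R]%classic.
have UA : \bigcup_n A n = `]0, +oo[%classic.
  apply/seteqP; split => [x [n _] /=|x]; rewrite /A /= !in_itv/= ?andbT.
    by move=> /andP[+ _]; apply: lt_le_trans; rewrite invr_gt0.
  move=> x0; have [n _ nx] := near_infty_natSinv_lt (PosNum x0).
  have [m _ mx] := nbhs_infty_ger x.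
  exists (maxn n m) => //=; rewrite /A/= in_itv/=; apply/andP; split.
    by apply/ltW/nx => /=; exact: leq_maxl.
  apply: (@le_trans _ _ m%:R); first by apply: mx => /=.
  by rewrite ler_nat leqW// leq_maxr.
have AD n : A n `<=` `]0, +oo[%classic.
  by rewrite -UA; exact: bigcup_sup.
have Agt0 n x : A n x -> 0 < x by move=> /AD; rewrite /= in_itv/= andbT.
have ndA : nondecreasing_seq A.
  move=> n m nm; rewrite subsetEset => x; rewrite /A/= !in_itv/= => /andP[nx xn].
  rewrite (le_trans _ nx) ?(le_trans xn)// ?ler_nat// lef_pV2 ?posrE// ler_nat//.
have mA n : measurable (A n : set (measurableTypeR R)) by exact: measurable_itv.
have mfA n : measurable_fun (A n : set (measurableTypeR R)) (abse \o (EFin \o f)).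
  apply: measurableT_comp => //; apply/measurable_EFinP.
  exact: (measurable_funS _ (@AD n)).
have := @ge0_nondecreasing_set_cvg_integral _ (measurableTypeR R) R A
  (abse \o (EFin \o f)) (@lebesgue_measure R) ndA mA mfA (fun _ _ _ => abse_ge0 _).
rewrite UA => /cvg_lim <- //.
apply: (@le_lt_trans _ _ (M + M)%:E); last exact: ltry.
apply: lime_le.
  apply: ereal_nondecreasing_is_cvgn => n m nm.
  apply: (@ge0_subset_integral _ (measurableTypeR R) R _ (A n) (A m)) => //.
    by move=> x _; exact: abse_ge0.
  by rewrite -subsetEset; exact: ndA.
apply: nearW => n /=.
have Fc x : 0 < x -> {for x, continuous F}.
  by move=> /dF [/derivable1_diffP/differentiable_continuous].
(* For [n = 0] the interval is the single point 1, while the fundamental theorem is applied between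
   distinct endpoints. *)
have [|n1] := eqVneq n 0%N.
  move=> ->; rewrite /A invr1 set_itv1 integral_set1 lee_fin.
  have := FM _ (@ltr01 R); have := normr_ge0 (F 1); lra.
have ab : (n.+1%:R)^-1 < n.+1%:R :> R.
  rewrite (@lt_trans _ _ 1)// ?invf_lt1// ltr1n// ltnS lt0n//.
have a0 : 0 < (n.+1%:R)^-1 :> R by rewrite invr_gt0.
rewrite (@eq_integral _ (measurableTypeR R) R mu (A n) (EFin \o f)); last first.
  by move=> x; rewrite inE/= => /Agt0 x0; rewrite ger0_norm// f0.
rewrite (@continuous_FTC2 _ _ F)//.
- rewrite -EFinB lee_fin.
  have := FM _ a0; have := FM _ (lt_trans a0 ab).
  by rewrite !ler_norml => /andP[? ?] /andP[? ?]; lra.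
- apply: continuous_in_subspaceT => x; rewrite inE => /Agt0; exact: cf.
- split.
  + move=> x; rewrite in_itv/= => /andP[x1 _].
    by case: (dF x (lt_trans a0 x1)).
  + exact/cvg_at_right_filter/Fc.
  + exact/cvg_at_left_filter/Fc/(lt_trans a0).
- move=> x; rewrite in_itv/= => /andP[x1 _].
  by rewrite derive1E; case: (dF x (lt_trans a0 x1)).
Qed.

(** Extending [f] by zero outside the rectangle reduces the claim to Tonelli's theorem on the
    plane. *)
Lemma tonelli_on (R : realType) (A B : set R) (f : R -> R -> R) :
  measurable A -> measurable B ->
  measurable_fun (A `*` B) (fun z : R * R => f z.1 z.2) ->
  (forall x y, A x -> B y -> 0 <= f x y) ->
  (\int[mu]_(x in A) \int[mu]_(y in B) (f x y)%:E =
   \int[mu]_(y in B) \int[mu]_(x in A) (f x y)%:E)%E.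
Proof.
move=> mA mB mf f0.
pose g (z : R * R) : \bar R := ((fun z : R * R => (f z.1 z.2)%:E) \_ (A `*` B)) z.
have mg : measurable_fun setT g.
  apply/(measurable_restrictT _ _).1; first exact: measurableX.
  exact/measurable_EFinP.
have g0 z : (0 <= g z)%E.
  by apply: erestrict_ge0 => -[x y] [/= Ax By]; rewrite lee_fin f0.
transitivity (\int[mu]_x \int[mu]_y g (x, y))%E.
  rewrite integral_mkcond; apply: eq_integral => x _.
  rewrite patchE; case: ifPn => [|/negP]; rewrite inE => Ax.
    rewrite integral_mkcond; apply: eq_integral => y _.
    rewrite /g !patchE; congr (if _ then _ else _).
    by apply/idP/idP; rewrite !inE//= => -[].
  rewrite integral0_eq// => y _; rewrite /g patchE; case: ifPn => //.
  by rewrite inE/= => -[].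
rewrite (@fubini_tonelli _ _ _ _ _ (@lebesgue_measure R) (@lebesgue_measure R) g mg g0).
rewrite [RHS]integral_mkcond; apply: eq_integral => y _.
rewrite patchE; case: ifPn => [|/negP]; rewrite inE => By.
  rewrite [RHS]integral_mkcond; apply: eq_integral => x _.
  rewrite /g !patchE; congr (if _ then _ else _).
  by apply/idP/idP; rewrite !inE//= => -[].
rewrite integral0_eq// => x _; rewrite /g patchE; case: ifPn => //.
by rewrite inE/= => -[].
Qed.

(* Near [s] both [b ^ s] and [|ln b|] are controlled by two extremal powers of [b], which gives the dominating function. *)
Lemma powR_norm_ln_le (R : realType) (b s s0 d : R) : 0 < b -> 0 < d ->
  s0 - d < s < s0 + d ->
  b `^ s * `|ln b| <= d^-1 * (b `^ (s0 - d *+ 2) + b `^ (s0 + d *+ 2)).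
Proof.
move=> b0 d0 /andP[s1 s2].
have powE x : b `^ x = expR (x * ln b) by rewrite /powR gt_eqF.
rewrite mulrC ler_pdivlMl// mulrA.
have -> : d * `|ln b| = `|d * ln b| by rewrite normrM (gtr0_norm d0).
rewrite !powE.
have [l0|l0] := leP 0 (ln b).
  rewrite ger0_norm ?mulr_ge0 ?(ltW d0)//.
  apply: (@le_trans _ _ (expR (d * ln b) * expR (s * ln b))).
    rewrite ler_pM2r ?expR_gt0//; have := expR_ge1Dx (d * ln b); lra.
  rewrite -expRD -[leLHS]add0r lerD ?expR_ge0// ler_expR -mulrDl ler_wpM2r//.
  by rewrite mulr2n; lra.
rewrite ltr0_norm ?pmulr_rlt0//.
apply: (@le_trans _ _ (expR (- (d * ln b)) * expR (s * ln b))).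
  rewrite ler_pM2r ?expR_gt0//; have := expR_ge1Dx (- (d * ln b)); lra.
rewrite -expRD -[leLHS]addr0 lerD ?expR_ge0// ler_expR -mulNr -mulrDl.
rewrite ler_wnM2r ?(ltW l0)// mulr2n; lra.
Qed.

Lemma is_derive_powR_exponent (R : realType) (b s : R) : 0 < b ->
  is_derive s 1 (powR b) (b `^ s * ln b).
Proof.
move=> b0.
have -> : powR b = expR \o (fun x => x * ln b).
  by apply/funext => x; rewrite /= /powR gt_eqF.
by apply: is_derive_eq; rewrite /= scaler0 add0r /GRing.scale/= mulr1.
Qed.

(** Integrability on an open window of exponents is enough: the logarithm produced by the derivative
    is absorbed by moving the exponent to either side, which yields one dominating function for all
    nearby [s]. *)
Lemma derive_integral_powR dT (T : measurableType dT) (R : realType)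
  (m : {measure set T -> \bar R}) (D : set T) (w b : T -> R) (s0 d : R) :
  measurable D -> measurable_fun D b ->
  (forall x, D x -> 0 <= w x) -> (forall x, D x -> 0 < b x) -> 0 < d ->
  (forall s, s0 - d < s < s0 + d ->
    m.-integrable D (EFin \o (fun x => w x * b x `^ s))) ->
  m.-integrable D
    (EFin \o (fun x => w x * (b x `^ s0 * ln (b x)))) /\
  is_derive s0 1 (fun s => \int[m]_(x in D) (w x * b x `^ s))
    (\int[m]_(x in D) (w x * (b x `^ s0 * ln (b x)))).
Proof.
move=> mD mb w0 b0 d0 If.
(* A third of [d]: the derivative is bounded for [s] within [e] of [s0] by means of the exponents
   [s0 - 2 e] and [s0 + 2 e], which still lie in the window. *)
pose e := d / 3.
have e0 : 0 < e by rewrite divr_gt0.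
pose f s x := w x * b x `^ s.
pose I : set R := `]s0 - e, s0 + e[%classic.
have Ia : I s0 by rewrite /I/= in_itv/=; apply/andP; split; rewrite /e; lra.
have intf s : I s -> m.-integrable D (EFin \o f s).
  rewrite /I/= in_itv/= => /andP[]; rewrite /e => ? ?; apply: If.
  by apply/andP; split; rewrite /e; lra.
have df (s : R) x : D x -> is_derive s 1 (f ^~ x) (w x * (b x `^ s * ln (b x))).
  move=> Dx; have := is_derive_powR_exponent s (b0 _ Dx) => ?.
  by apply: is_derive_eq.
pose G0 x := e^-1 * (w x * b x `^ (s0 - e *+ 2) + w x * b x `^ (s0 + e *+ 2)).
(* Extension by zero: the theorem on differentiation under the integral asks for a bound that is
   nonnegative on the whole space. *)
pose G := G0 \_ D.
have intG0 : m.-integrable D (EFin \o G0).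
  have Iw s : s0 - d < s < s0 + d -> m.-integrable D
    (fun x => (w x * b x `^ s)%:E) by exact: If.
  have I1 : s0 - d < s0 - e *+ 2 < s0 + d.
    by apply/andP; split; rewrite /e mulr2n; lra.
  have I2 : s0 - d < s0 + e *+ 2 < s0 + d.
    by apply/andP; split; rewrite /e mulr2n; lra.
  have := integrableZl mD e^-1 (integrableD mD (Iw _ I1) (Iw _ I2)).
  by apply: eq_integrable => // x _; rewrite /= EFinM EFinD.
have intG : m.-integrable D (EFin \o G).
  apply: eq_integrable intG0 => // x; rewrite inE => Dx.
  by rewrite /= /G patchE mem_set.
have G0ge x : D x -> 0 <= G0 x.
  move=> Dx; rewrite /G0 mulr_ge0 ?invr_ge0 ?(ltW e0)//.
  by rewrite addr_ge0// mulr_ge0 ?w0 ?powR_ge0.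
have G_ge0 x : 0 <= G x.
  by rewrite /G patchE; case: ifPn => //; rewrite inE => /G0ge.
have fG s x : I s -> D x -> `|w x * (b x `^ s * ln (b x))| <= G x.
  rewrite /I/= in_itv/= => sI Dx.
  rewrite /G patchE mem_set// /G0 !normrM (ger0_norm (w0 _ Dx)).
  rewrite (ger0_norm (powR_ge0 _ _)) -mulrDr [leRHS]mulrCA ler_wpM2l ?w0//.
  by apply: powR_norm_ln_le => //; exact: b0.
have d1E s x : D x -> partial1of2 f s x = w x * (b x `^ s * ln (b x)).
  by move=> Dx; rewrite partial1of2E; case: (df s _ Dx).
have derf (s : R) x : I s -> D x -> derivable (f ^~ x) s 1.
  by move=> _ Dx; case: (df s _ Dx).
have fG' s x : I s -> D x -> `|partial1of2 f s x| <= G x.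
  by move=> Is Dx; rewrite d1E//; exact: fG.
split.
  apply: (le_integrable mD _ _ intG).
    apply/measurable_EFinP.
    have /integrableP[/measurable_EFinP mf _] := intf _ Ia.
    rewrite (_ : (fun x => _) = (fun x => f s0 x * ln (b x))); last first.
      by apply/funext => x; rewrite mulrA.
    apply: measurable_funM => //.
    exact: measurableT_comp (@measurable_ln R) mb.
  by move=> x Dx /=; rewrite lee_fin (ger0_norm (G_ge0 _)) fG.
split.
  exact: (derivable_under_integral mD Ia intf derf G_ge0 intG fG').
rewrite -derive1E.
rewrite (differentiation_under_integral mD Ia intf derf G_ge0 intG fG').
by apply: eq_Rintegral => x; rewrite inE => Dx; exact: d1E.
Qed.

Lemma derive_integral_powR_gt0 (R : realType) (w b : R -> R) (s0 d : R) :
  measurable_fun (`]0%R, +oo[%classic : set R) b ->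
  (forall x : R, 0 < x -> 0 <= w x) -> (forall x : R, 0 < x -> 0 < b x) -> 0 < d ->
  (forall s : R, s0 - d < s < s0 + d ->
    (@lebesgue_measure R).-integrable `]0, +oo[
      (EFin \o (fun x => w x * b x `^ s))) ->
  (@lebesgue_measure R).-integrable `]0, +oo[
    (EFin \o (fun x => w x * (b x `^ s0 * ln (b x)))) /\
  is_derive s0 1 (fun s => \int[mu]_(x in `]0%R, +oo[) (w x * b x `^ s))
    (\int[mu]_(x in `]0%R, +oo[) (w x * (b x `^ s0 * ln (b x)))).
Proof.
move=> mb w0 b0 d0 If.
apply: (@derive_integral_powR _ (measurableTypeR R) R mu _ w b s0 d) => //.
- by move=> x /=; rewrite in_itv/= andbT; exact: w0.
- by move=> x /=; rewrite in_itv/= andbT; exact: b0.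
Qed.

(** * The Gamma function and beta-prime integrals *)

Lemma is_derive1_cstD (R : realType) (f : R -> R) (k x df : R) :
  is_derive x 1 f df -> is_derive x 1 (fun t => k + f t) df.
Proof.
move=> d; have := is_deriveD (is_derive_cst k x (1 : R)) d.
by rewrite add0r.
Qed.

Lemma is_derive1_mul (R : realType) (f g : R -> R) (x df dg : R) :
  is_derive x 1 f df -> is_derive x 1 g dg ->
  is_derive x 1 (fun t => f t * g t) (f x * dg + g x * df).
Proof. exact: is_deriveM. Qed.

Lemma is_derive1_Mcst (R : realType) (f : R -> R) (k x df : R) :
  is_derive x 1 f df -> is_derive x 1 (fun t => f t * k) (df * k).
Proof.
move=> d; have := is_derive1_mul d (is_derive_cst k x (1 : R)).
by rewrite mulr0 add0r mulrC.
Qed.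

Lemma powRE_gt0 (R : realType) (b s : R) : 0 < b -> b `^ s = expR (s * ln b).
Proof. by move=> b0; rewrite /powR gt_eqF. Qed.

(** Take [ln z <= z] at [z = t / (2 s)], multiply by [s] and exponentiate. *)
Lemma powR_le_expR (R : realType) (s t : R) : 0 < s -> 0 < t ->
  t `^ s <= (2 * s) `^ s * expR (t / 2).
Proof.
move=> s0 t0; rewrite !powRE_gt0 ?mulr_gt0// -expRD ler_expR.
have p : 0 < t / (2 * s) by rewrite divr_gt0 ?mulr_gt0.
have := ln_sublinear p; rewrite ln_div ?posrE ?mulr_gt0// => h.
have : s * (ln t - ln (2 * s)) <= s * (t / (2 * s)) by rewrite ler_pM2l// ltW.
have -> : s * (t / (2 * s)) = t / 2 by field; rewrite gt_eqF.
lra.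
Qed.

Lemma measurable_Gamma_integrand (R : realType) (s c : R) (D : set R) :
  measurable_fun D (fun t : R => t `^ s * expR (- (c * t))).
Proof.
apply: measurable_funTS; apply: measurable_funM; first exact: measurable_powR.
apply: measurableT_comp; first exact: measurable_expR.
by apply: measurable_funN; apply: measurable_funM.
Qed.

(* The integrand is dominated by a multiple of the derivative of the bounded function [- (1 + t ^ s)^-1]. *)
Lemma Gamma_integrable (R : realType) (s : R) : 0 < s ->
  (@lebesgue_measure R).-integrable `]0, +oo[
    (EFin \o (fun t => t `^ (s - 1) * expR (- t))).
Proof.
move=> s0.
(* With this [K], [1 + t^s <= K exp(t/2)]; squaring gives [exp(-t) <= K^2 / (1 + t^s)^2], which is
   the domination by [f]. *)
pose K : R := 1 + (2 * s) `^ s.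
have K1 : 1 <= K by rewrite /K lerDl powR_ge0.
pose F t : R := (- (K ^+ 2 / s)) *: (1 + t `^ s)^-1.
pose f t : R := K ^+ 2 * t `^ (s - 1) * (1 + t `^ s) ^- 2.
have p1 t : 0 < 1 + t `^ s by rewrite ltr_wpDr ?powR_ge0.
have dP (x a : R) : 0 < x -> is_derive x 1 (fun t : R => t `^ a) (a * x `^ (a - 1)).
  exact: is_derive1_powR.
have dF (x : R) : 0 < x -> is_derive x 1 F (f x).
  move=> x0; have d1 := dP x s x0.
  have d2 : is_derive x 1 (fun t : R => 1 + t `^ s) (s * x `^ (s - 1)).
    exact: is_derive1_cstD.
  have d3 := is_deriveV (f := fun t : R => 1 + t `^ s) (lt0r_neq0 (p1 x)) d2.
  have d4 := is_deriveZ (- (K ^+ 2 / s)) d3.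
  rewrite (_ : f x = - (K ^+ 2 / s) *: (- (1 + x `^ s) ^- 2 *: (s * x `^ (s - 1)))) //.
  rewrite /f /GRing.scale/=; field.
  by rewrite !gt_eqF.
have cf (x : R) : 0 < x -> {for x, continuous f}.
  move=> x0; apply: differentiable_continuous; apply/derivable1_diffP.
  have d1 := dP x s x0; have d2 := dP x (s - 1) x0.
  have d3 : is_derive x 1 (fun t : R => (1 + t `^ s) ^+ 2)
      ((1 + x `^ s) *+ 2 *: (s * x `^ (s - 1))).
    have := is_deriveX 2 (is_derive1_cstD 1 d1); rewrite expr1 mulr_natl.
    by [].
  have n0 : (1 + x `^ s) ^+ 2 != 0 by rewrite expf_neq0// lt0r_neq0.
  have d4 := is_deriveV (f := fun t : R => (1 + t `^ s) ^+ 2) n0 d3.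
  by apply: derivableM; [apply: derivableM|case: d4].
have f0 (x : R) : 0 < x -> 0 <= f x.
  move=> x0; apply: divr_ge0; last exact: sqr_ge0.
  by apply: mulr_ge0; [exact: sqr_ge0|exact: powR_ge0].
have FM (x : R) : 0 < x -> `|F x| <= K ^+ 2 / s.
  move=> x0; rewrite /F normrZ normrN ger0_norm ?divr_ge0 ?sqr_ge0 ?(ltW s0)//.
  rewrite ler_piMr ?divr_ge0 ?sqr_ge0 ?(ltW s0)// ger0_norm ?invr_ge0 ?(ltW (p1 _))//.
  by rewrite invf_le1// lerDl powR_ge0.
have If := ge0_integrable_bounded_primitive f0 cf dF FM.
have mI : measurable (`]0%R, +oo[%classic : set (measurableTypeR R)).
  exact: measurable_itv.
apply: (le_integrable mI _ _ If).
  apply/measurable_EFinP.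
  apply: eq_measurable_fun (@measurable_Gamma_integrand R (s - 1) 1 _) => t _.
  by rewrite mul1r.
move=> t; rewrite /= in_itv/= andbT => t0.
rewrite lee_fin !ger0_norm ?f0// ?mulr_ge0 ?powR_ge0 ?expR_ge0//.
rewrite /f [K ^+ 2 * _]mulrC -mulrA ler_wpM2l ?powR_ge0//.
rewrite ler_pdivlMr ?exprn_gt0// expRN ler_pdivrMl ?expR_gt0//.
have -> : expR t = expR (t / 2) ^+ 2.
  by rewrite expr2 -expRD; congr expR; field.
rewrite mulrC -exprMn ler_pXn2r ?nnegrE ?(ltW (p1 _))//; last first.
  by rewrite mulr_ge0 ?expR_ge0// (le_trans _ K1).
rewrite /K mulrDl mul1r lerD//; last exact: powR_le_expR.
by rewrite -expR0 ler_expR divr_ge0 ?(ltW t0).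
Qed.

(** If the integral were zero, [f] would vanish almost everywhere on [D]; as it is positive there,
    [D] would be contained in a null set. *)
Lemma Rintegral_gt0 dT (T : measurableType dT) (R : realType)
    (m : {measure set T -> \bar R}) (D : set T) (f : T -> R) :
  measurable D -> m D != 0%E -> (forall x, D x -> 0 < f x) ->
  m.-integrable D (EFin \o f) -> 0 < \int[m]_(x in D) f x.
Proof.
move=> mD mD0 f0 If; rewrite lt0r; apply/andP; split; last first.
  by apply: Rintegral_ge0 => x Dx; rewrite ltW ?f0.
apply/negP => /eqP I0.
have mf : measurable_fun D (EFin \o f) by exact: measurable_int If.
have : (\int[m]_(x in D) `|(EFin \o f) x| = 0)%E.
  rewrite -[RHS]/(0%:E) -I0 /Rintegral fineK; last exact: integrable_fin_num.
  by apply: eq_integral => x; rewrite inE => Dx; rewrite /= gtr0_norm ?f0.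
move/(ae_eq_integral_abs m mD mf) => [N [mN N0 DN]].
have : (m D <= m N)%E.
  apply: le_measure; rewrite ?inE// => x Dx; apply: DN => /= /(_ Dx) [] /eqP.
  by rewrite gt_eqF ?f0.
by rewrite [leRHS]N0 measure_le0 (negbTE mD0).
Qed.

Lemma Gamma_gt0 (R : realType) (s : R) : 0 < s -> 0 < Gamma s.
Proof.
move=> s0; apply: Rintegral_gt0 (Gamma_integrable s0) => //.
  by rewrite /= lebesgue_measure_itv/= ltry.
by move=> t; rewrite /= in_itv/= andbT => t0; rewrite mulr_gt0 ?powR_gt0 ?expR_gt0.
Qed.

Lemma GammaE (R : realType) (s : R) : 0 < s ->
  (\int[mu]_(t in `]0%R, +oo[) (t `^ (s - 1) * expR (- t))%:E = (Gamma s)%:E)%E.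
Proof.
by move=> s0; rewrite fineK//; apply: integrable_fin_num (Gamma_integrable s0).
Qed.

Lemma integral_powR_expR (R : realType) (s c : R) : 0 < s -> 0 < c ->
  (\int[mu]_(t in `]0%R, +oo[) (t `^ (s - 1) * expR (- (c * t)))%:E
   = (c `^ (- s) * Gamma s)%:E)%E.
Proof.
move=> s0 c0.
have m1 : measurable_fun (`]0, +oo[%classic : set R)
    (fun t => t `^ (s - 1) * expR (- t)).
  apply: eq_measurable_fun (@measurable_Gamma_integrand R (s - 1) 1 _) => t _.
  by rewrite mul1r.
have := GammaE s0; rewrite (ge0_integral_scale c0 m1); last first.
  by move=> x x0; rewrite mulr_ge0 ?powR_ge0 ?expR_ge0.
rewrite (@eq_integral _ (measurableTypeR R) R mu `]0%R, +oo[%classic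
  (fun t => (c `^ (s - 1))%:E * (t `^ (s - 1) * expR (- (c * t)))%:E)%E); last first.
  move=> t; rewrite inE/= in_itv/= andbT => t0.
  by rewrite powRM ?(ltW c0) ?(ltW t0)// -EFinM mulrA.
rewrite ge0_integralZl_EFin ?powR_ge0//; last 2 first.
- by move=> t _; rewrite lee_fin mulr_ge0 ?powR_ge0 ?expR_ge0.
- by apply/measurable_EFinP; exact: measurable_Gamma_integrand.
rewrite muleA -EFinM mulr_powRB1 ?(ltW c0)// => h.
have cs : 0 < c `^ s by rewrite powR_gt0.
rewrite powRN EFinM -h muleA -EFinM mulVf ?mul1e// gt_eqF//.
Qed.

Lemma integrable_powR_expR (R : realType) (s c : R) : 0 < s -> 0 < c ->
  (@lebesgue_measure R).-integrable `]0, +oo[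
    (EFin \o (fun t => t `^ (s - 1) * expR (- (c * t)))).
Proof.
move=> s0 c0; apply/integrableP; split.
  by apply/measurable_EFinP; exact: measurable_Gamma_integrand.
rewrite (@eq_integral _ (measurableTypeR R) R mu `]0%R, +oo[%classic
  (EFin \o (fun t => t `^ (s - 1) * expR (- (c * t))))).
  by rewrite integral_powR_expR// ltry.
by move=> t _; rewrite /= ger0_norm// mulr_ge0 ?powR_ge0 ?expR_ge0.
Qed.

(** Up to sign, both sides are the derivative at [c = 1] of [c^(-s) Gamma s]: one through its
    integral representation, the other by the power rule. *)
Lemma GammaDr1 (R : realType) (s : R) : 0 < s -> Gamma (s + 1) = s * Gamma s.
Proof.
move=> s0.
have mb : measurable_fun (`]0, +oo[%classic : set (measurableTypeR R))
    (fun t : R => expR (- t)).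
  by apply: measurable_funTS; apply: measurableT_comp => //; exact: measurable_expR.
(* The base is [exp(-t)] and the exponent is [c]; the logarithm of the base, [-t], is what raises
   the power of [t] by one. *)
have bE (t c : R) : expR (- t) `^ c = expR (- (c * t)) by rewrite -expRM mulNr mulrC.
have If (c : R) : 1 - 1 < c < 1 + 1 -> (@lebesgue_measure R).-integrable `]0, +oo[
    (EFin \o (fun t => t `^ (s - 1) * expR (- t) `^ c)).
  rewrite subrr => /andP[c0 _]; have := integrable_powR_expR s0 c0.
  by apply: eq_integrable => // t _ /=; rewrite bE.
have [_] := derive_integral_powR_gt0 mb
  (fun t _ => powR_ge0 t (s - 1)) (fun t _ => expR_gt0 (- t)) ltr01 If.
set I := (X in is_derive _ _ _ X) => dI.
have IE : I = - Gamma (s + 1).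
  rewrite /I -[RHS]mulN1r /Gamma -RintegralZl//; last first.
    exact: (Gamma_integrable (addr_gt0 s0 ltr01)).
  apply: eq_Rintegral => t; rewrite inE/= in_itv/= andbT => t0.
  by rewrite powRr1 ?expR_ge0// expRK addrK -(mulr_powRB1 (ltW t0) s0); ring.
have d1 : is_derive (1 : R) 1 (fun c => c `^ (- s) * Gamma s) I.
  apply: near_eq_is_derive dI.
  near=> c; have c0 : 0 < c by near: c; exact: lt_nbhsr.
  have := integral_powR_expR s0 c0; rewrite /Rintegral => h.
  under eq_integral do rewrite bE.
  by rewrite h.
have d2 : is_derive (1 : R) 1 (fun c => c `^ (- s) * Gamma s) (- s * Gamma s).
  have d3 := @is_derive1_powR R (- s) 1 ltr01.
  by have := is_derive1_Mcst (Gamma s) d3; rewrite powR1 mulr1.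
apply: oppr_inj; rewrite -IE -mulNr.
by case: d1 => _ <-; case: d2 => _ <-.
Unshelve. all: by end_near. Qed.

Lemma Gamma1 (R : realType) : Gamma 1 = 1 :> R.
Proof.
have If := Gamma_integrable (@ltr01 R).
have : (\int[mu]_(t in `[0%R, +oo[) (expR (- t))%:E = 0%:E - (- expR (- 0))%:E :> \bar R)%E.
  apply: (@ge0_continuous_FTC2y _ _ (fun t => - expR (- t))).
  - by move=> t _; exact: expR_ge0.
  - apply: continuous_subspaceT => t.
    by apply: continuous_comp; [exact: opp_continuous|exact: continuous_expR].
  - by rewrite -oppr0; apply: cvgN; exact: cvgr_expR.
  - by move=> t _; exact: ex_derive.
  - apply: cvg_at_right_filter; apply: cvgN.
    by apply: continuous_comp; [exact: opp_continuous|exact: continuous_expR].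
  - move=> t _; rewrite derive1E derive_val/=.
    by rewrite /GRing.scale/=; ring.
rewrite -integral_itv_obnd_cbnd; last first.
  apply/measurable_EFinP/measurable_funTS.
  by apply: measurableT_comp => //; exact: measurable_expR.
rewrite oppr0 expR0 => h; rewrite /Gamma.
under eq_integral do rewrite subrr powRr0 mul1r.
by rewrite h -EFinB/= sub0r opprK.
Qed.

(** This time the base is [t] and the exponential is the weight. The exponent moves around [s - 1]
    with radius [s], so it stays above -1, where the integral is finite. *)
Lemma derive_integral_expR_powR (R : realType) (s c : R) : 0 < s -> 0 < c ->
  (@lebesgue_measure R).-integrable `]0, +oo[
    (EFin \o (fun t => expR (- (c * t)) * (t `^ (s - 1) * ln t))) /\
  is_derive s 1 (fun s => c `^ (- s) * Gamma s)
    (\int[mu]_(t in `]0%R, +oo[) (expR (- (c * t)) * (t `^ (s - 1) * ln t))).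
Proof.
move=> s0 c0.
have If (x : R) : s - 1 - s < x < s - 1 + s ->
    (@lebesgue_measure R).-integrable `]0, +oo[
    (EFin \o (fun t => expR (- (c * t)) * t `^ x)).
  rewrite addrAC subrr sub0r => /andP[x0 _].
  have x1 : 0 < x + 1 by lra.
  have := integrable_powR_expR x1 c0.
  by apply: eq_integrable => // t _ /=; rewrite addrK mulrC.
have [I1 dI] := derive_integral_powR_gt0 (@measurable_id _ _ _)
  (fun t _ => expR_ge0 (- (c * t))) (fun t t0 => t0) s0 If.
split; first exact: I1.
have d1 : is_derive s 1 (fun s : R => s - 1) 1.
  by apply: is_derive_eq; rewrite subr0.
have := @is_derive1_comp R _ (fun s : R => s - 1) s _ _ dI d1; rewrite mulr1.
apply: near_eq_is_derive.
near=> x; have x0 : 0 < x by near: x; exact: lt_nbhsr.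
have := integral_powR_expR x0 c0 => h.
rewrite /= /Rintegral.
under eq_integral do rewrite mulrC.
by rewrite h.
Unshelve. all: by end_near. Qed.

Lemma is_derive_Gamma (R : realType) (s : R) : 0 < s ->
  is_derive s 1 Gamma (Gamma s * digamma s).
Proof.
move=> s0; have [_ [d _]] := derive_integral_expR_powR s0 ltr01.
have {}d : derivable (Gamma : R -> R) s 1.
  by apply: near_eq_derivable d; near=> x; rewrite powR1 mul1r.
split => //; rewrite /digamma derive1E mulrCA divff ?mulr1//.
by rewrite gt_eqF// Gamma_gt0.
Unshelve. all: by end_near. Qed.

(** The derivative of [c^(-s) Gamma s] at [s = 1] is computed twice: under the integral, and by the
    product rule, where [Gamma 1 = 1] makes the derivative of Gamma at 1 equal to minus the Euler
    constant. *)
Lemma integral_expR_ln (R : realType) (c : R) : 0 < c ->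
  \int[mu]_(t in `]0%R, +oo[) (expR (- (c * t)) * ln t)
  = c^-1 * (- euler_mascheroni - ln c) :> R.
Proof.
move=> c0; have [_ d] := derive_integral_expR_powR (@ltr01 R) c0.
have d1 := is_derive_Gamma (@ltr01 R).
have d2 : is_derive (1 : R) 1 (fun s : R => c `^ (- s)) (- (c^-1 * ln c)).
  have d3 := is_derive_powR_exponent (- 1) c0.
  have d4 := is_deriveNid (1 : R) 1.
  have := is_derive1_comp d3 d4; rewrite powR_inv1 ?(ltW c0)//.
  by rewrite mulrN1.
have d3 : is_derive (1 : R) 1 (fun s : R => c `^ (- s) * Gamma s)
   (c^-1 * (- euler_mascheroni - ln c)).
  have := is_derive1_mul d2 d1; rewrite powR_inv1 ?(ltW c0)// Gamma1.
  by rewrite (_ : _ + _ = c^-1 * (- euler_mascheroni - ln c))//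
    /euler_mascheroni opprK; ring.
case: d3 => _ <-; case: d => _ ->.
by apply: eq_Rintegral => t _; rewrite subrr powRr0 mul1r.
Qed.

Lemma measurable_inv1D (R : realType) :
  measurable_fun (`]0%R, +oo[%classic : set R) (fun u : R => (1 + u)^-1).
Proof.
apply: (@eq_measurable_fun _ _ _ _ _ (fun u : R => (1 + u) `^ (- 1))).
  move=> u; rewrite inE/= in_itv/= andbT => u0.
  by rewrite powR_inv1// addr_ge0// ltW.
have m1 : measurable_fun setT (fun u : R => 1 + u) by exact: measurable_funD.
by have := measurableT_comp (measurable_powR (- 1)) m1; exact: measurable_funTS.
Qed.

Lemma measurable_betaprime (R : realType) (p s : R) :
  measurable_fun (`]0%R, +oo[%classic : set R)
    (fun u : R => u `^ (p - 1) * (1 + u)^-1 `^ s).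
Proof.
apply: measurable_funM; first by apply: measurable_funTS; exact: measurable_powR.
exact: measurableT_comp (measurable_powR s) (@measurable_inv1D R).
Qed.

(** Tonelli for [u^(p-1) y^(p+q-1) exp(-(1+u) y)]: integrating in [y] first gives [Gamma (p + q)]
    times the wanted integral, integrating in [u] first gives [Gamma p * Gamma q]. *)
Lemma integral_betaprime (R : realType) (p q : R) : 0 < p -> 0 < q ->
  (\int[mu]_(u in `]0%R, +oo[) (u `^ (p - 1) * (1 + u)^-1 `^ (p + q))%:E
   = (Gamma p * Gamma q / Gamma (p + q))%:E)%E.
Proof.
move=> p0 q0; have pq0 : 0 < p + q by rewrite addr_gt0.
have G0 := Gamma_gt0 pq0.
pose f (u y : R) := u `^ (p - 1) * (y `^ (p + q - 1) * expR (- ((1 + u) * y))).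
have mI : measurable (`]0%R, +oo[%classic : set R) by exact: measurable_itv.
have mf : measurable_fun ((`]0%R, +oo[ : set R) `*` (`]0%R, +oo[ : set R))
    (fun z : R * R => f z.1 z.2).
  apply: measurable_funTS; apply: measurable_funM.
    exact: measurableT_comp (measurable_powR _) measurable_fst.
  apply: measurable_funM.
    exact: measurableT_comp (measurable_powR _) measurable_snd.
  apply: measurableT_comp; first exact: measurable_expR.
  apply: measurable_funN; apply: measurable_funM => //.
  exact: measurable_funD.
have f0 (u y : R) : (`]0%R, +oo[%classic : set R) u -> (`]0%R, +oo[%classic : set R) y -> 0 <= f u y.
  by move=> _ _; rewrite /f !mulr_ge0 ?powR_ge0 ?expR_ge0.
have := tonelli_on mI mI mf f0.
have -> : (\int[mu]_(u in `]0%R, +oo[) \int[mu]_(y in `]0%R, +oo[) (f u y)%:E =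
  (Gamma (p + q))%:E *
  \int[mu]_(u in `]0%R, +oo[) (u `^ (p - 1) * (1 + u)^-1 `^ (p + q))%:E)%E.
  rewrite -ge0_integralZl_EFin ?(ltW G0)//; last 2 first.
  - by move=> u _; rewrite lee_fin mulr_ge0 ?powR_ge0.
  - by apply/measurable_EFinP; exact: measurable_betaprime.
  apply: eq_integral => u; rewrite inE/= in_itv/= andbT => u0.
  have u1 : 0 < 1 + u by rewrite addr_gt0.
  rewrite /f; under eq_integral do rewrite EFinM.
  rewrite ge0_integralZl_EFin ?powR_ge0//; last 2 first.
  - by move=> y _; rewrite lee_fin mulr_ge0 ?powR_ge0 ?expR_ge0.
  - by apply/measurable_EFinP; exact: measurable_Gamma_integrand.
  rewrite integral_powR_expR// -!EFinM; congr EFin.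
  rewrite [_^-1 `^ _](_ : _ = (1 + u) `^ (- (p + q))); first by ring.
  by rewrite -powR_inv1 ?(ltW u1)// -powRrM mulN1r.
have -> : (\int[mu]_(y in `]0%R, +oo[) \int[mu]_(u in `]0%R, +oo[) (f u y)%:E =
  (Gamma p * Gamma q)%:E)%E.
  rewrite EFinM -(GammaE q0) -ge0_integralZl_EFin ?(ltW (Gamma_gt0 p0))//; last 2 first.
  - by move=> y _; rewrite lee_fin mulr_ge0 ?powR_ge0 ?expR_ge0.
  - apply/measurable_EFinP.
    apply: eq_measurable_fun (@measurable_Gamma_integrand R (q - 1) 1 _) => t _.
    by rewrite mul1r.
  apply: eq_integral => y; rewrite inE/= in_itv/= andbT => y0.
  rewrite (@eq_integral _ (measurableTypeR R) R mu `]0%R, +oo[%classic (fun u =>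
    (y `^ (p + q - 1) * expR (- y))%:E * (u `^ (p - 1) * expR (- (y * u)))%:E)%E);
    last first.
    move=> u _; rewrite -EFinM; congr EFin; rewrite /f mulrDl mul1r opprD expRD.
    by rewrite [u * y]mulrC; ring.
  rewrite ge0_integralZl_EFin ?mulr_ge0 ?powR_ge0 ?expR_ge0//; last 2 first.
  - by move=> u _; rewrite lee_fin mulr_ge0 ?powR_ge0 ?expR_ge0.
  - by apply/measurable_EFinP; exact: measurable_Gamma_integrand.
  rewrite integral_powR_expR// -!EFinM; congr EFin.
  have -> : q - 1 = (p + q - 1) + - p by ring.
  rewrite (@powRD _ y (p + q - 1) (- p)); first by ring.
  by rewrite (gt_eqF y0) implybT.
move=> h; rewrite [RHS]EFinM -h muleAC -EFinM mulfV ?mul1e// gt_eqF//.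
Qed.

Lemma betaprime_integrable (R : realType) (p q : R) : 0 < p -> 0 < q ->
  (@lebesgue_measure R).-integrable `]0, +oo[
    (EFin \o (fun u => u `^ (p - 1) * (1 + u)^-1 `^ (p + q))).
Proof.
move=> p0 q0; apply/integrableP; split.
  by apply/measurable_EFinP; exact: measurable_betaprime.
rewrite (@eq_integral _ (measurableTypeR R) R mu `]0%R, +oo[%classic
  (EFin \o (fun u => u `^ (p - 1) * (1 + u)^-1 `^ (p + q)))).
  by rewrite integral_betaprime// ltry.
by move=> t _; rewrite /= ger0_norm// mulr_ge0 ?powR_ge0.
Qed.

(** For fixed [p], differentiate [Gamma p * Gamma (s - p) / Gamma s] at [s = p + q]; the radius [q]
    keeps [s - p] positive. *)
Lemma integral_betaprime_ln (R : realType) (p q : R) : 0 < p -> 0 < q ->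
  (@lebesgue_measure R).-integrable `]0, +oo[
    (EFin \o (fun u => u `^ (p - 1) * ((1 + u)^-1 `^ (p + q) * ln (1 + u)^-1))) /\
  \int[mu]_(u in `]0%R, +oo[)
    (u `^ (p - 1) * ((1 + u)^-1 `^ (p + q) * ln (1 + u)^-1))
  = Gamma p * Gamma q / Gamma (p + q) * (digamma q - digamma (p + q)).
Proof.
move=> p0 q0; have pq0 : 0 < p + q by rewrite addr_gt0.
have If (s : R) : p + q - q < s < p + q + q ->
    (@lebesgue_measure R).-integrable `]0, +oo[
      (EFin \o (fun u => u `^ (p - 1) * (1 + u)^-1 `^ s)).
  rewrite addrK => /andP[ps _]; have r0 : 0 < s - p by rewrite subr_gt0.
  have := betaprime_integrable p0 r0.
  by rewrite (_ : p + (s - p) = s)//; ring.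
have b0 (u : R) : 0 < u -> 0 < (1 + u)^-1.
  by move=> u0; rewrite invr_gt0 addr_gt0.
have [I1 d] := derive_integral_powR_gt0 (@measurable_inv1D R)
  (fun u _ => powR_ge0 u (p - 1)) b0 q0 If.
split; first exact: I1.
have d1 : is_derive (p + q) 1 (fun s : R => s - p) 1.
  have := is_derive1_cstD (- p) (is_derive_id (p + q) (1 : R)).
  by rewrite (_ : (fun t : R => - p + id t) = (fun s => s - p))//;
    apply/funext => t; rewrite addrC.
have qE : p + q - p = q by ring.
have d2 : is_derive (p + q) 1 (fun s : R => Gamma (s - p)) (Gamma q * digamma q).
  have := is_derive_Gamma q0; rewrite -{1}qE => dG.
  by have := @is_derive1_comp R _ (fun s : R => s - p) _ _ _ dG d1; rewrite mulr1.
have G0 := Gamma_gt0 pq0.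
have d3 := is_deriveV (f := @Gamma R) (lt0r_neq0 G0) (is_derive_Gamma pq0).
have d4 := is_derive1_Mcst (Gamma p) (is_derive1_mul d2 d3).
have d5 : is_derive (p + q) 1
    (fun s => \int[mu]_(x in `]0%R, +oo[) (x `^ (p - 1) * (1 + x)^-1 `^ s))
    ((Gamma (p + q - p) *
          (- Gamma (p + q) ^- 2 *: (Gamma (p + q) * digamma (p + q))) +
          (Gamma (p + q))^-1 * (Gamma q * digamma q)) *
         Gamma p).
  apply: near_eq_is_derive d4.
  near=> s; have ps : p < s by near: s; apply: lt_nbhsr; rewrite ltrDl.
  have r0 : 0 < s - p by rewrite subr_gt0.
  rewrite /Rintegral; have := integral_betaprime p0 r0.
  rewrite (_ : p + (s - p) = s); last by ring.
  move=> ->; rewrite [fine _]/=.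
  by move: (Gamma _) (Gamma _) (Gamma _) => *; ring.
case: d => _ <-; case: d5 => _ ->.
rewrite qE; move: (lt0r_neq0 G0).
move: (Gamma (p + q)) (Gamma p) (Gamma q) (digamma q) (digamma (p + q)).
by move=> *; rewrite /GRing.scale/=; field.
Unshelve. all: by end_near. Qed.

(** * Exponential integrals and power series *)

(** This exchanges an exponential density with the integral of [1/x] that represents a difference of
    logarithms; it is used once above and once below the splitting point [y]. *)
Lemma tonelli_triangle (R : realType) (A : set R) (G H : R -> R) :
  measurable A -> measurable_fun setT G -> measurable_fun setT H ->
  (forall t, 0 <= G t) -> (forall x, 0 <= H x) ->
  (\int[mu]_(t in A)
     ((G t)%:E * \int[mu]_(x in A `&` [set x | (x < t)%R]) (H x)%:E) =
   \int[mu]_(x in A)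
     ((H x)%:E * \int[mu]_(t in A `&` [set t | (x < t)%R]) (G t)%:E))%E.
Proof.
move=> mA mG mH G0 H0.
pose f (t x : R) := if x < t then G t * H x else 0.
have mf : measurable_fun (A `*` A) (fun z : R * R => f z.1 z.2).
  apply: measurable_funTS; apply: measurable_fun_ifT => //.
    by apply: measurable_fun_ltr; [exact: measurable_snd|exact: measurable_fst].
  apply: measurable_funM.
    exact: measurableT_comp mG measurable_fst.
  exact: measurableT_comp mH measurable_snd.
have f0 (t x : R) : A t -> A x -> 0 <= f t x.
  by move=> _ _; rewrite /f; case: ifPn => // _; rewrite mulr_ge0.
have mlt (t : R) : measurable (A `&` [set x | x < t] : set (measurableTypeR R)).
  by apply: measurableI => //; rewrite -set_itvE; exact: measurable_itv.
have mgt (t : R) : measurable (A `&` [set x | t < x] : set (measurableTypeR R)).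
  by apply: measurableI => //; rewrite -set_itvE; exact: measurable_itv.
transitivity (\int[mu]_(t in A) \int[mu]_(x in A) (f t x)%:E)%E.
  apply: eq_integral => t _.
  rewrite -ge0_integralZl_EFin//; last 2 first.
  - by move=> x _; rewrite lee_fin.
  - by apply/measurable_EFinP; exact: measurable_funTS.
  rewrite integral_mkcondr; apply: eq_integral => x _.
  rewrite patchE /f; have [xt|xt] := boolP (x < t).
    by rewrite mem_set//= EFinM.
  by rewrite memNset//=; exact/negP.
rewrite tonelli_on//; apply: eq_integral => x _.
rewrite -ge0_integralZl_EFin//; last 2 first.
- by move=> t _; rewrite lee_fin.
- by apply/measurable_EFinP; exact: measurable_funTS.
rewrite integral_mkcondr; apply: eq_integral => t _.
rewrite patchE /f; have [xt|xt] := boolP (x < t).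
  by rewrite mem_set//= EFinM muleC.
by rewrite memNset//=; exact/negP.
Qed.

(** Here and below [1/x] is written as a real power with exponent -1, so that its measurability is
    that of [powR]. *)
Lemma integral_inv (R : realType) (a b : R) : 0 < a -> a < b ->
  (\int[mu]_(x in `]a, b[) (x `^ (- 1))%:E = (ln b - ln a)%:E)%E.
Proof.
move=> a0 ab.
have mf : measurable_fun (`]a, b[%classic : set R) (EFin \o (fun x => x `^ (- 1))).
  by apply/measurable_EFinP/measurable_funTS; exact: measurable_powR.
rewrite -(integral_itv_bndoo true false mf).
have dl (x : R) : 0 < x -> is_derive x 1 (@ln R) x^-1 by exact: is_derive1_ln.
rewrite (@continuous_FTC2 _ _ (@ln R))//.
- apply: continuous_in_subspaceT => x; rewrite inE/= in_itv/= => /andP[ax _].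
  have x0 : 0 < x := lt_le_trans a0 ax.
  apply: differentiable_continuous; apply/derivable1_diffP.
  by case: (is_derive1_powR (- 1) x0).
- split.
  + move=> x; rewrite in_itv/= => /andP[ax _].
    by case: (dl x (lt_trans a0 ax)).
  + by apply: cvg_at_right_filter; exact: continuous_ln.
  + by apply: cvg_at_left_filter; apply: continuous_ln; exact: lt_trans ab.
- move=> x; rewrite in_itv/= => /andP[ax _].
  have x0 := lt_trans a0 ax.
  by rewrite derive1E powR_inv1 ?(ltW x0)//; case: (dl x x0).
Qed.

Lemma continuous_expRNM (R : realType) (c : R) : continuous (fun t : R => expR (- (c * t))).
Proof.
move=> x; apply: differentiable_continuous; apply/derivable1_diffP.
exact: ex_derive.
Qed.

Lemma derive1_NexpRNM (R : realType) (c x : R) :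
  derive1 (fun t : R => - expR (- (c * t))) x = c * expR (- (c * x)).
Proof. by rewrite derive1E derive_val /GRing.scale/=; ring. Qed.

Lemma integral_expRNM_ge (R : realType) (c a : R) : 0 < c ->
  (\int[mu]_(t in `]a, +oo[) (c * expR (- (c * t)))%:E = (expR (- (c * a)))%:E)%E.
Proof.
move=> c0.
rewrite integral_itv_obnd_cbnd; last first.
  apply/measurable_EFinP/measurable_funM => //; apply: measurable_funTS.
  by apply: continuous_measurable_fun; exact: continuous_expRNM.
rewrite (@ge0_continuous_FTC2y _ _ (fun t => - expR (- (c * t))) _ 0).
- by rewrite -EFinB sub0r opprK.
- by move=> x _; rewrite mulr_ge0 ?expR_ge0 ?(ltW c0).
- apply: continuous_subspaceT => t; apply: cvgM; first exact: cvg_cst.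
  exact: continuous_expRNM.
- rewrite -oppr0; apply: cvgN.
  apply: (@cvg_comp _ _ _ (fun t => c * t) (fun t => expR (- t)) _ +oo).
    by apply: (gt0_cvgMry c0); exact: cvg_id.
  exact: cvgr_expR.
- by move=> x _; exact: ex_derive.
- by apply: cvg_at_right_filter; apply: cvgN; exact: continuous_expRNM.
- by move=> x _; exact: derive1_NexpRNM.
Qed.

Lemma integral_expRNM_lt (R : realType) (c a : R) : 0 < a ->
  (\int[mu]_(t in `]0%R, a[) (c * expR (- (c * t)))%:E = (1 - expR (- (c * a)))%:E)%E.
Proof.
move=> a0.
have cf : continuous (fun t : R => c * expR (- (c * t))).
  by move=> t; apply: cvgM; [exact: cvg_cst|exact: continuous_expRNM].
have mf : measurable_fun (`]0%R, a[%classic : set R) (EFin \o (fun t => c * expR (- (c * t)))).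
  by apply/measurable_EFinP/measurable_funTS; exact: continuous_measurable_fun.
rewrite -(integral_itv_bndoo true false mf).
rewrite (@continuous_FTC2 _ _ (fun t => - expR (- (c * t))))//.
- by rewrite mulr0 oppr0 expR0 -EFinB opprK addrC.
- exact: continuous_subspaceT.
- split.
  + by move=> x _; exact: ex_derive.
  + by apply: cvg_at_right_filter; apply: cvgN; exact: continuous_expRNM.
  + by apply: cvg_at_left_filter; apply: cvgN; exact: continuous_expRNM.
- by move=> x _; exact: derive1_NexpRNM.
Qed.

(** Scaling by [y] keeps the base of the powers in the unit interval, as termwise integration of a
    power series requires below. *)
Lemma integral_expn_div (R : realType) (y : R) (k : nat) : 0 < y ->
  \int[mu]_(x in `]0%R, y[) ((x / y) ^+ k) = y / k.+1%:R.
Proof.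
move=> y0.
have cf : continuous (fun x : R => (x / y) ^+ k).
  have e1 : continuous (fun x : R => x / y).
    by move=> x; apply: cvgM; [exact: cvg_id|exact: cvg_cst].
  by move=> x; exact: (continuous_comp (e1 x) (@exprn_continuous R k _)).
have mf : measurable_fun (`]0%R, y[%classic : set R) (EFin \o (fun x => (x / y) ^+ k)).
  by apply/measurable_EFinP/measurable_funTS; exact: continuous_measurable_fun.
rewrite /Rintegral -(integral_itv_bndoo true false mf).
pose F (x : R) := (y / k.+1%:R) *: (x / y) ^+ k.+1.
have dF (x : R) : is_derive x 1 F ((x / y) ^+ k).
  have d1 := is_derive1_Mcst y^-1 (is_derive_id x (1 : R)).
  have d2 := is_deriveZ (y / k.+1%:R) (is_deriveX k.+1 d1).
  have EF : F = (y / k.+1%:R) \*: ((fun t : R => id t * y^-1) ^+ k.+1).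
    by apply/funext => t; rewrite /F exprfctE.
  move: d2; set v := (X in is_derive _ _ _ X) => d2.
  suff E : (x / y) ^+ k = v by rewrite E EF; exact: d2.
  rewrite /v /GRing.scale/=; field.
  by rewrite (gt_eqF y0)/= addrC natr1 pnatr_eq0.
have cF : continuous F.
  move=> x; apply: differentiable_continuous; apply/derivable1_diffP.
  by case: (dF x).
rewrite (@continuous_FTC2 _ _ F)//.
- rewrite -EFinB/= /F mul0r expr0n/= scaler0 subr0 divff ?gt_eqF// expr1n.
  by rewrite /GRing.scale/= mulr1.
- exact: continuous_subspaceT.
- split.
  + by move=> x _; case: (dF x).
  + by apply: cvg_at_right_filter; exact: cF.
  + by apply: cvg_at_left_filter; exact: cF.
- by move=> x _; rewrite derive1E; case: (dF x).
Qed.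

(** Since [|g| <= 1], all partial sums are dominated by [|w|] times the sum of the [|c k|], and
    dominated convergence applies. The lemma serves three expansions: in [x / y], in [1 - 2 B] and
    in [B]. *)
Lemma Rintegral_power_series dT (T : measurableType dT) (R : realType)
    (m : {measure set T -> \bar R}) (D : set T) (w g : T -> R) (c : R^nat) :
  measurable D -> measurable_fun D g -> (forall x, D x -> `|g x| <= 1) ->
  m.-integrable D (EFin \o w) -> cvgn (series (fun k => `|c k|)) ->
  m.-integrable D
    (EFin \o (fun x => w x * limn (series (fun k => c k * g x ^+ k)))) /\
  series (fun k => c k * \int[m]_(x in D) (w x * g x ^+ k)) @ \oo -->
    \int[m]_(x in D) (w x * limn (series (fun k => c k * g x ^+ k))).
Proof.
move=> mD mg g1 Iw cc.
pose C := limn (series (fun k => `|c k|)).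
have le1 x k : D x -> `|c k * g x ^+ k| <= `|c k|.
  by move=> Dx; rewrite normrM normrX ler_piMr// exprn_ile1// g1.
have cg x : D x -> cvgn (series (fun k => c k * g x ^+ k)).
  move=> Dx; apply: normed_cvg; apply: series_le_cvg cc => k //=.
  exact: le1.
have mw : measurable_fun D w by have /measurable_EFinP := measurable_int _ Iw.
pose f_ n x := (w x * series (fun k => c k * g x ^+ k) n)%:E.
pose f x := (w x * limn (series (fun k => c k * g x ^+ k)))%:E.
have Iwg k : m.-integrable D (EFin \o (fun x => w x * g x ^+ k)).
  apply: (le_integrable mD _ _ Iw).
    by apply/measurable_EFinP/measurable_funM => //; exact: measurable_funX.
  move=> x Dx /=; rewrite lee_fin normrM normrX ler_piMr//.
  by rewrite exprn_ile1// g1.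
have f_E n : (\int[m]_(x in D) f_ n x =
    (series (fun k => c k * \int[m]_(x in D) (w x * g x ^+ k)) n)%:E)%E.
  rewrite /f_ /series/=.
  under eq_integral do rewrite mulr_sumr -sumEFin.
  rewrite integral_sum//; last first.
    move=> k; have := integrableZl mD (c k) (Iwg k).
    by apply: eq_integrable => // x _ /=; rewrite -EFinM mulrCA.
  rewrite -sumEFin; apply: eq_bigr => k _.
  rewrite EFinM /Rintegral fineK; last exact: integrable_fin_num (Iwg k).
  rewrite -integralZl//; last exact: Iwg.
  by apply: eq_integral => x _; rewrite /= -EFinM mulrCA.
have mf_ n : measurable_fun D (f_ n).
  apply/measurable_EFinP/measurable_funM => //.
  rewrite /series/=; apply: measurable_sum => k.
  by apply: measurable_funM => //; exact: measurable_funX.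
have f_f x : D x -> f_ ^~ x @ \oo --> f x.
  move=> Dx; apply: cvg_EFin; first exact: nearW.
  by apply: cvgM; [exact: cvg_cst|exact: cg].
have mf : measurable_fun D f by exact: emeasurable_fun_cvg mf_ f_f.
have IwC : m.-integrable D (fun x => (`|w x| * C)%:E).
  have := integrableZl mD C (integrable_norm Iw).
  by apply: eq_integrable => // x _ /=; rewrite mulrC.
have fC x n : D x -> (`|f_ n x| <= (`|w x| * C)%:E)%E.
  move=> Dx; rewrite /f_ /= lee_fin normrM ler_wpM2l//.
  apply: (@le_trans _ _ (series (fun k => `|c k|) n)).
    rewrite /series/= (le_trans (ler_norm_sum _ _ _))//.
    by apply: ler_sum => k _; exact: le1.
  by apply: nondecreasing_cvgn_le => //; apply: nondecreasing_series.
have [If _ cv] := dominated_convergence mD mf_ mf (aeW _ f_f) IwC (aeW _ fC).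
split; first exact: If.
move: cv; rewrite -(fineK (integrable_fin_num mD If)) => /fine_cvg.
by apply: cvg_trans; apply: near_eq_cvg; apply: nearW => n /=; rewrite f_E.
Qed.

Lemma cvg_series_1BexpR (R : realType) (z : R) :
  series (fun k => (- 1) ^+ k * z ^+ k.+1 / k.+1`!%:R) @ \oo --> 1 - expR (- z).
Proof.
have -> : series (fun k => (- 1) ^+ k * z ^+ k.+1 / k.+1`!%:R) =
    (fun n => 1 - series (exp_coeff (- z)) n.+1).
  apply/funext => n; rewrite /series/= big_nat_recl// /exp_coeff/=.
  rewrite expr0 fact0 divr1 opprD addrA subrr add0r -sumrN.
  by apply: eq_bigr => k _; rewrite [(- z) ^+ _]exprNn [(- 1) ^+ k.+1]exprS; ring.
apply: cvgB; first exact: cvg_cst.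
by rewrite (cvg_shiftS (series (exp_coeff (- z)))); exact: is_cvg_series_exp_coeff.
Qed.

(** As [1/(k+1)! <= 1/k!], the terms are dominated by [K |z|] times those of the exponential series
    at [|z|]. *)
Lemma is_cvg_series_norm_le_exp (R : realType) (K z : R) (u : R^nat) :
  0 <= K -> (forall k, `|u k| <= K * (`|z| ^+ k.+1 / k.+1`!%:R)) ->
  cvgn (series (fun k => `|u k|)).
Proof.
move=> K0 uz; apply: (@series_le_cvg _ _ (fun k => K * `|z| * exp_coeff `|z| k)).
- by move=> k.
- by move=> k; rewrite !mulr_ge0// exp_coeff_ge0.
- move=> k; apply: (le_trans (uz k)); rewrite -mulrA ler_wpM2l//.
  rewrite exprS /exp_coeff/= -mulrA ler_wpM2l//.
  rewrite ler_wpM2l ?exprn_ge0// lef_pV2 ?posrE ?ltr0n ?fact_gt0//.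
  by rewrite ler_nat factS leq_pmull.
- rewrite (_ : series _ = (fun n => K * `|z| * series (exp_coeff `|z|) n)).
    by apply: is_cvgM; [exact: is_cvg_cst|exact: is_cvg_series_exp_coeff].
  by apply/funext => n; rewrite /series/= mulr_sumr.
Qed.

(** The limit is the entire exponential integral Ein at [c y], obtained by termwise integration. *)
Lemma cvg_series_Ein (R : realType) (c y : R) : 0 < c -> 0 < y ->
  series (fun k => (- 1) ^+ k * (c * y) ^+ k.+1 / (k.+1%:R * k.+1`!%:R)) @ \oo -->
  \int[mu]_(x in `]0%R, y[) ((1 - expR (- (c * x))) * x `^ (- 1)).
Proof.
move=> c0 y0.
(* Coefficients of [(1 - exp(-c x)) / x] in powers of [x / y]; the [y] in the denominator
   compensates for the extra factor in [(c y)^(k+1)]. *)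
pose e k : R := (- 1) ^+ k * (c * y) ^+ k.+1 / (y * k.+1`!%:R).
pose D : set (measurableTypeR R) := `]0%R, y[%classic.
have mD : measurable D by exact: measurable_itv.
have mg : measurable_fun D (fun x : R => x / y).
  by apply: measurable_funM.
have g1 (x : R) : D x -> `|x / y| <= 1.
  rewrite /D/= in_itv/= => /andP[x0 xy].
  by rewrite ger0_norm ?divr_ge0 ?ltW// ltr_pdivrMr// mul1r.
have I1 : (@lebesgue_measure R).-integrable D (EFin \o (fun _ : R => 1)).
  apply/integrableP; split; first exact/measurable_EFinP.
  rewrite (@eq_integral _ (measurableTypeR R) R mu D (cst 1%E)); last first.
    by move=> x _; rewrite /= normr1.
  by rewrite integral_cst//= mul1e /D lebesgue_measure_itv/= lte_fin y0 ltry.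
have ce : cvgn (series (fun k => `|e k|)).
  apply: (@is_cvg_series_norm_le_exp _ y^-1 (c * y)); first by rewrite invr_ge0 ltW.
  move=> k; rewrite /e !normrM normfV !normrX normrN1 expr1n mul1r !normrM.
  by rewrite (gtr0_norm y0) normr_nat invfM; lra.
have [_] := Rintegral_power_series mD mg g1 I1 ce.
have -> : \int[mu]_(x in D) (1 * limn (series (fun k => e k * (x / y) ^+ k))) =
    \int[mu]_(x in `]0%R, y[) ((1 - expR (- (c * x))) * x `^ (- 1)).
  apply: eq_Rintegral => x; rewrite inE /D/= in_itv/= => /andP[x0 xy].
  rewrite mul1r powR_inv1 ?(ltW x0)//; apply: cvg_lim => //.
  have -> : series (fun k => e k * (x / y) ^+ k) =
    (fun n => series (fun k => (- 1) ^+ k * (c * x) ^+ k.+1 / k.+1`!%:R) n * x^-1).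
    apply/funext => n; rewrite /series/= mulr_suml; apply: eq_bigr => k _.
    rewrite /e; rewrite !exprMn exprVn !exprS; field.
    rewrite ?expf_neq0 ?gt_eqF ?pnatr_eq0// ltr0n fact_gt0//.
  by apply: cvgM; [exact: cvg_series_1BexpR|exact: cvg_cst].
rewrite (_ : (fun k => e k * \int[mu]_(x in D) _) =
  (fun k => (- 1) ^+ k * (c * y) ^+ k.+1 / (k.+1%:R * k.+1`!%:R)))//.
apply/funext => k.
under eq_Rintegral do rewrite mul1r.
rewrite integral_expn_div// /e; field.
by rewrite ?gt_eqF ?pnatr_eq0// ltr0n ?fact_gt0//.
Qed.

(** This is the classical relation [E_1(z) = Ein(z) - gamma - ln z] at [z = c y]. *)
Lemma integral_expR_div (R : realType) (c y : R) : 0 < c -> 0 < y ->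
  (\int[mu]_(x in `]y, +oo[) (x `^ (- 1) * expR (- (c * x)))%:E =
   (\int[mu]_(x in `]0%R, y[) ((1 - expR (- (c * x))) * x `^ (- 1))
     - euler_mascheroni - ln c - ln y)%:E)%E.
Proof.
move=> c0 y0.
pose G (t : R) := c * expR (- (c * t)).
pose H (x : R) := x `^ (- 1).
have mG : measurable_fun setT G.
  apply: measurable_funM => //.
  by apply: continuous_measurable_fun; exact: continuous_expRNM.
have mH : measurable_fun setT H by exact: measurable_powR.
have G0 (t : R) : 0 <= G t by rewrite mulr_ge0 ?expR_ge0 ?(ltW c0).
have H0 (x : R) : 0 <= H x by exact: powR_ge0.
(* The integral of [h] over the half-line is known from [integral_expR_ln]; [A1] and [A2] identify
   its parts above and below [y]. *)
pose h (t : R) := G t * (ln t - ln y).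
(* Above [y], [ln t - ln y] is the integral of [1/x] from [y] to [t], and the mass of [G] beyond [x]
   is [exp(-c x)]. *)
have A1 : (\int[mu]_(x in `]y, +oo[) (x `^ (- 1) * expR (- (c * x)))%:E =
    \int[mu]_(t in `]y, +oo[) (h t)%:E)%E.
  have := @tonelli_triangle R `]y, +oo[ G H (measurable_itv _) mG mH G0 H0.
  set L := (X in X = _ -> _); set K := (X in _ = X -> _).
  have -> : L = (\int[mu]_(t in `]y, +oo[) (h t)%:E)%E.
    apply: eq_integral => t; rewrite inE/= in_itv/= andbT => yt.
    have -> : `]y, +oo[ `&` [set x | x < t] = `]y, t[%classic.
      apply/seteqP; split => x /=; rewrite !in_itv/= ?andbT.
        by move=> [-> ->].
      by move=> /andP[-> ->].
    by rewrite integral_inv// -EFinM.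
  have -> : K = (\int[mu]_(x in `]y, +oo[) (x `^ (- 1) * expR (- (c * x)))%:E)%E.
    apply: eq_integral => x; rewrite inE/= in_itv/= andbT => yx.
    have -> : `]y, +oo[ `&` [set t | x < t] = `]x, +oo[%classic.
      apply/seteqP; split => t /=; rewrite !in_itv/= ?andbT.
        by move=> [].
      by move=> xt; split => //; exact: lt_trans xt.
    by rewrite integral_expRNM_ge// -EFinM.
  by move=> ->.
(* Below [y] the sign is reversed: [ln y - ln t] is the integral of [1/x] from [t] to [y], and the
   mass of [G] on []0, x[] is [1 - exp(-c x)]. Hence [G] and [H] trade places. *)
have A2 : (\int[mu]_(x in `]0%R, y[) ((1 - expR (- (c * x))) * x `^ (- 1))%:E =
    \int[mu]_(t in `]0%R, y[) (- h t)%:E)%E.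
  have := @tonelli_triangle R `]0, y[ H G (measurable_itv _) mH mG H0 G0.
  set L := (X in X = _ -> _); set K := (X in _ = X -> _).
  have -> : L = (\int[mu]_(x in `]0%R, y[) ((1 - expR (- (c * x))) * x `^ (- 1))%:E)%E.
    apply: eq_integral => x; rewrite inE/= in_itv/= => /andP[x0 xy].
    have -> : `]0, y[ `&` [set t | t < x] = `]0, x[%classic.
      apply/seteqP; split => t /=; rewrite !in_itv/=.
        by move=> [/andP[-> _] ->].
      by move=> /andP[-> tx]; rewrite tx (lt_trans tx).
    by rewrite integral_expRNM_lt// -EFinM mulrC.
  have -> : K = (\int[mu]_(t in `]0%R, y[) (- h t)%:E)%E.
    apply: eq_integral => t; rewrite inE/= in_itv/= => /andP[t0 ty].
    have -> : `]0, y[ `&` [set x | t < x] = `]t, y[%classic.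
      apply/seteqP; split => x /=; rewrite !in_itv/=.
        by move=> [/andP[_ ->] ->].
      by move=> /andP[tx ->]; rewrite tx (lt_trans t0).
    by rewrite integral_inv// -EFinM /h -mulrN opprB.
  by move=> ->.
have [I1 _] := derive_integral_expR_powR (@ltr01 R) c0.
have I2 := integrable_powR_expR (@ltr01 R) c0.
pose D : set (measurableTypeR R) := `]0%R, +oo[%classic.
have mD : measurable D by exact: measurable_itv.
have J1 : (@lebesgue_measure R).-integrable D (EFin \o (fun t => expR (- (c * t)) * ln t)).
  by apply: eq_integrable I1 => // t _ /=; rewrite subrr powRr0 mul1r.
have J2 : (@lebesgue_measure R).-integrable D (EFin \o (fun t => expR (- (c * t)))).
  by apply: eq_integrable I2 => // t _ /=; rewrite subrr powRr0 mul1r.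
have J1' : (@lebesgue_measure R).-integrable D
    (EFin \o (fun t => c * (expR (- (c * t)) * ln t))).
  by have := integrableZl mD c J1.
have J2' : (@lebesgue_measure R).-integrable D
    (EFin \o (fun t => (c * ln y) * expR (- (c * t)))).
  by have := integrableZl mD (c * ln y) J2.
have hE : h = (fun t => c * (expR (- (c * t)) * ln t) - (c * ln y) * expR (- (c * t))).
  by apply/funext => t; rewrite /h /G; ring.
have Ih : (@lebesgue_measure R).-integrable D (EFin \o h).
  by rewrite hE; have := integrableB mD J1' J2'.
have Dh : \int[mu]_(t in D) h t = - euler_mascheroni - ln c - ln y.
  rewrite hE RintegralB// !RintegralZl// integral_expR_ln//.
  rewrite -/D.
  have -> : \int[mu]_(t in D) expR (- (c * t)) = c^-1.
    have := integral_powR_expR (@ltr01 R) c0.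
    rewrite Gamma1 mulr1 powR_inv1 ?(ltW c0)// => E.
    rewrite /Rintegral (_ : integral _ _ _ = (c^-1)%:E)// -E.
    by apply: eq_integral => t _; rewrite subrr powRr0 mul1r.
  by field; rewrite gt_eqF.
(* The integral over []y, +oo[] is the full integral of [h] minus the part below [y]. *)
have := @Rintegral_itvB R h (BRight 0) +oo%O y Ih.
rewrite bnd_simp (ltW y0) => /(_ isT isT).
have mDy : measurable (`]y, +oo[%classic : set (measurableTypeR R)).
  exact: measurable_itv.
have mD0 : measurable (`]0%R, y[%classic : set (measurableTypeR R)).
  exact: measurable_itv.
have Iy : (@lebesgue_measure R).-integrable `]y, +oo[ (EFin \o h).
  apply: (integrableS mD mDy) Ih => x; rewrite /D/= !in_itv/= !andbT.
  exact: lt_trans.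
have I0 : (@lebesgue_measure R).-integrable `]0, y[ (EFin \o h).
  by apply: (integrableS mD mD0) Ih => x; rewrite /D/= !in_itv/= => /andP[->].
rewrite -(@Rintegral_itv_bndo_bndc _ (BRight 0) y h I0).
rewrite Dh A1 => E.
rewrite -[LHS](fineK (integrable_fin_num mDy Iy)); congr EFin.
rewrite -[LHS]/(\int[mu]_(t in `]y, +oo[) h t) -E.
have -> : \int[mu]_(x in `]0%R, y[) ((1 - expR (- (c * x))) * x `^ (- 1)) =
    - \int[mu]_(t in `]0%R, y[) h t.
  rewrite -[RHS]mulN1r; apply: etrans; last exact: (RintegralZl (-1) mD0 I0).
  rewrite {1}/Rintegral A2.
  by congr fine; apply: eq_integral => t _; rewrite mulN1r.
ring.
Qed.

(** * Moments of the symmetric beta law and the Bessel function *)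

Definition beta_weight {R : realType} (a u : R) : R :=
  u `^ (a - 1) * (1 + u)^-1 `^ (a + a).

(** With [B = 1 / (1 + u)], this is the expectation of [B^j (1 - 2 B)^k] under Beta(a, a) without
    normalisation; [beta_moment a 0 0] is the total mass. *)
Definition beta_moment {R : realType} (a : R) (j k : nat) : R :=
  \int[mu]_(u in `]0%R, +oo[)
    (beta_weight a u * ((1 + u)^-1 ^+ j * (1 - 2 * (1 + u)^-1) ^+ k)).

Lemma inv1D_itv (R : realType) (u : R) : 0 < u -> 0 < (1 + u)^-1 < 1.
Proof.
move=> u0; have u1 : 1 < 1 + u by rewrite ltrDl.
by rewrite invr_gt0 invf_lt1 ?(lt_trans ltr01 u1)// u1.
Qed.

Lemma beta_weight_ge0 (R : realType) (a u : R) : 0 <= beta_weight a u.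
Proof. by rewrite mulr_ge0 ?powR_ge0. Qed.

Lemma beta_weight_moment_integrable (R : realType) (a : R) (j k : nat) : 0 < a ->
  (@lebesgue_measure R).-integrable `]0, +oo[ (EFin \o (fun u =>
    beta_weight a u * ((1 + u)^-1 ^+ j * (1 - 2 * (1 + u)^-1) ^+ k))).
Proof.
move=> a0.
pose D : set (measurableTypeR R) := `]0%R, +oo[%classic.
have mD : measurable D by exact: measurable_itv.
have mb := @measurable_inv1D R.
apply: (le_integrable mD _ _ (betaprime_integrable a0 a0)).
  apply/measurable_EFinP; apply: measurable_funM; first exact: measurable_betaprime.
  apply: measurable_funM; first exact: measurable_funX.
  apply: measurable_funX; apply: measurable_funB => //.
  exact: measurable_funM.
move=> u; rewrite /D/= in_itv/= andbT => /inv1D_itv /andP[b0 b1].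
rewrite lee_fin normrM ler_piMr// normrM !normrX mulr_ile1 ?exprn_ge0//.
  by rewrite exprn_ile1// ger0_norm ?ltW.
by rewrite exprn_ile1// ler_norml; apply/andP; split; lra.
Qed.

Lemma beta_momentS (R : realType) (a : R) (j k : nat) : 0 < a ->
  beta_moment a j k.+1 = beta_moment a j k - 2 * beta_moment a j.+1 k.
Proof.
move=> a0.
pose D : set (measurableTypeR R) := `]0%R, +oo[%classic.
have mD : measurable D by exact: measurable_itv.
have I1 := beta_weight_moment_integrable j k a0.
have I2 := beta_weight_moment_integrable j.+1 k a0.
have I3 := integrableZl mD 2 I2.
rewrite /beta_moment -(RintegralZl 2 mD I2) -(RintegralB mD I1 I3).
by apply: eq_Rintegral => u _; rewrite /= !exprS; ring.
Qed.

Lemma beta_moment0r (R : realType) (a : R) (j : nat) : 0 < a ->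
  beta_moment a j 0 = Gamma a * Gamma (a + j%:R) / Gamma (a + (a + j%:R)).
Proof.
move=> a0; have aj : 0 < a + j%:R by rewrite ltr_wpDr.
have := integral_betaprime a0 aj => E.
rewrite /beta_moment /Rintegral (_ : integral _ _ _ =
  (Gamma a * Gamma (a + j%:R) / Gamma (a + (a + j%:R)))%:E)// -E.
apply: eq_integral => u; rewrite inE/= in_itv/= andbT => /inv1D_itv /andP[b0 _].
rewrite expr0 mulr1 /beta_weight addrA (@powRD _ _ (a + a)); last first.
  by rewrite (gt_eqF b0) implybT.
by rewrite powR_mulrn ?(ltW b0)// mulrA.
Qed.

Lemma beta_moment0S (R : realType) (a : R) (j : nat) : 0 < a ->
  (a + a + j%:R) * beta_moment a j.+1 0 = (a + j%:R) * beta_moment a j 0.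
Proof.
move=> a0; rewrite !(beta_moment0r _ a0).
have aj : 0 < a + j%:R by rewrite ltr_wpDr.
have aaj : 0 < a + (a + j%:R) by rewrite addr_gt0.
have -> : a + j.+1%:R = a + j%:R + 1 by ring.
rewrite addrA (GammaDr1 aj) (GammaDr1 aaj).
move: (lt0r_neq0 aaj) (lt0r_neq0 (Gamma_gt0 aaj)).
move: (Gamma a) (Gamma (a + j%:R)) (Gamma (a + (a + j%:R))) => *; field.
by apply/andP.
Qed.

(* Integration by parts in disguise: the Beta(a, a) law annihilates [a (2 B - 1) p - B (1 - B) p'], here for [p = B ^ j (1 - 2 B) ^ k]. *)
Lemma beta_moment_ibp (R : realType) (a : R) (j k : nat) : 0 < a ->
  a * beta_moment a j k.+1 + j%:R * (beta_moment a j k - beta_moment a j.+1 k)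
  = 2 * k%:R * (beta_moment a j.+1 k.-1 - beta_moment a j.+2 k.-1).
Proof.
move=> a0; elim: k j => [|k IH] j.
  have := beta_moment0S j a0; rewrite beta_momentS//= => h.
  rewrite mulr0 mul0r; apply/eqP; rewrite -subr_eq0; apply/eqP.
  transitivity ((a + j%:R) * beta_moment a j 0 -
    (a + a + j%:R) * beta_moment a j.+1 0); first by ring.
  by rewrite h subrr.
(* Multiplying [p] by [1 - 2 B] amounts to taking the instance at [j] minus twice the one at
   [j + 1]. *)
have h1 := IH j; have h2 := IH j.+1.
rewrite [beta_moment a j k.+2]beta_momentS//= mulrBr.
have -> : a * beta_moment a j k.+1 = 2 * k%:R * (beta_moment a j.+1 k.-1 - beta_moment a j.+2 k.-1)
  - j%:R * (beta_moment a j k - beta_moment a j.+1 k) by rewrite -h1; ring.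
have -> : a * (2 * beta_moment a j.+1 k.+1) =
  2 * (2 * k%:R * (beta_moment a j.+2 k.-1 - beta_moment a j.+3 k.-1)
  - j.+1%:R * (beta_moment a j.+1 k - beta_moment a j.+2 k)) by rewrite -h2; ring.
(* For [k = 0] the truncated predecessor is harmless: the coefficient [k%:R] in front of it
   vanishes. *)
case: k {IH h1 h2} => [|k] /=; rewrite !beta_momentS//; ring.
Qed.

Lemma beta_moment01 (R : realType) (a : R) : 0 < a -> beta_moment a 0 1 = 0.
Proof.
move=> a0; have := beta_moment_ibp 0 0 a0; rewrite mul0r addr0 mulr0 mul0r.
by move/eqP; rewrite mulf_eq0 (gt_eqF a0)/= => /eqP.
Qed.

(** The case [j = 0] of the integration by parts, with [4 B (1 - B) = 1 - (1 - 2 B)^2]. *)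
Lemma beta_moment0SS (R : realType) (a : R) (k : nat) : 0 < a ->
  (a + a + k.+1%:R) * beta_moment a 0 k.+2 = k.+1%:R * beta_moment a 0 k.
Proof.
move=> a0; have := beta_moment_ibp 0 k.+1 a0; rewrite mul0r addr0 /=.
have -> : beta_moment a 1 k - beta_moment a 2 k =
   (beta_moment a 0 k - beta_moment a 0 k.+2) / 4.
  by rewrite !beta_momentS//; lra.
move=> h; rewrite !mulrDl h.
by field.
Qed.

(** Iterating the two-step recurrence multiplies the ratios [(2 i + 1) / (2 a + 2 i + 1)]; the
    numerators give [(2 k)! / (2^k k!)], the denominators [2^k] times a quotient of Gamma values. *)
Lemma beta_moment_even (R : realType) (a : R) (k : nat) : 0 < a ->
  4 ^+ k * k`!%:R * Gamma (a + 2^-1 + k%:R) * beta_moment a 0 k.*2 =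
  Gamma (a + 2^-1) * beta_moment a 0 0 * k.*2`!%:R.
Proof.
move=> a0; elim: k => [|k IH].
  by rewrite expr0 fact0 addr0 !mul1r mulr1.
have r0 : 0 < a + 2^-1 + k%:R by rewrite ltr_wpDr// addr_gt0// invr_gt0.
have h := beta_moment0SS k.*2 a0.
have -> : a + 2^-1 + k.+1%:R = a + 2^-1 + k%:R + 1 by ring.
rewrite doubleS !factS !natrM GammaDr1//.
set X := _ * _ * (_ * _) * _.
have -> : X = 2 * k.+1%:R * (4 ^+ k * k`!%:R * Gamma (a + 2^-1 + k%:R)) *
   ((a + a + k.*2.+1%:R) * beta_moment a 0 k.*2.+2).
  by rewrite /X exprS -!natr1 -muln2 natrM; field.
rewrite h; transitivity (2 * k.+1%:R * k.*2.+1%:R *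
  (4 ^+ k * k`!%:R * Gamma (a + 2^-1 + k%:R) * beta_moment a 0 k.*2)); first by ring.
by rewrite IH -!natr1 -muln2 natrM; ring.
Qed.

Lemma beta_moment_odd (R : realType) (a : R) (k : nat) : 0 < a ->
  beta_moment a 0 k.*2.+1 = 0.
Proof.
move=> a0; elim: k => [|k IH]; first exact: beta_moment01.
have := beta_moment0SS k.*2.+1 a0; rewrite IH mulr0 doubleS => /eqP.
by rewrite mulf_eq0 gt_eqF ?addr_gt0//= => /eqP.
Qed.

(** Used because [2 n] terms of the moment series correspond to [n] terms of the Bessel series. *)
Lemma cvg_double (R : realType) (u : R^nat) (l : R) :
  u @ \oo --> l -> (fun n => u n.*2) @ \oo --> l.
Proof.
apply: cvg_comp => A [N _ NA]; exists N => // n /= Nn; apply: NA => /=.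
by rewrite (leq_trans Nn)// -addnn leq_addr.
Qed.

(** Termwise integration of the exponential series, allowed since [|1 - 2 B| <= 1]. *)
Lemma cvg_series_beta_moment (R : realType) (a x : R) : 0 < a ->
  series (fun n => x ^+ n / n`!%:R * beta_moment a 0 n) @ \oo -->
  \int[mu]_(u in `]0%R, +oo[)
    (beta_weight a u * expR (x * (1 - 2 * (1 + u)^-1))).
Proof.
move=> a0.
pose D : set (measurableTypeR R) := `]0%R, +oo[%classic.
have mD : measurable D by exact: measurable_itv.
have mg : measurable_fun D (fun u : R => 1 - 2 * (1 + u)^-1).
  apply: measurable_funB => //; apply: measurable_funM => //.
  exact: measurable_inv1D.
have g1 (u : R) : D u -> `|1 - 2 * (1 + u)^-1| <= 1.
  rewrite /D/= in_itv/= andbT => /inv1D_itv /andP[b0 b1].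
  by rewrite ler_norml; apply/andP; split; lra.
have cc : cvgn (series (fun k => `|x ^+ k / k`!%:R|)).
  rewrite (_ : (fun k => _) = exp_coeff `|x|); first exact: is_cvg_series_exp_coeff.
  by apply/funext => k; rewrite normrM normfV normrX normr_nat.
have [_] := Rintegral_power_series mD mg g1 (betaprime_integrable a0 a0) cc.
rewrite (_ : (fun k => x ^+ k / k`!%:R * _) =
  (fun n => x ^+ n / n`!%:R * beta_moment a 0 n)); last first.
  apply/funext => k; congr (_ * _); apply: eq_Rintegral => u _.
  by rewrite expr0 mul1r.
rewrite (_ : \int[mu]_(u in D) _ = \int[mu]_(u in `]0%R, +oo[)
    (beta_weight a u * expR (x * (1 - 2 * (1 + u)^-1))))//.
apply: eq_Rintegral => u _; congr (_ * _).
rewrite /expR; congr (limn (series _)); apply/funext => k.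
by rewrite /exp_coeff/= exprMn mulrAC.
Qed.

(* Kummer's second formula, with the confluent function written as a Beta integral. *)
Lemma besselIE (R : realType) (rho x : R) : 1 / 2 < rho -> 0 < x ->
  let a := rho - 1 / 2 in
  Gamma rho * beta_moment a 0 0 * besselI (rho - 1) x =
  (x / 2) `^ (rho - 1) * \int[mu]_(u in `]0%R, +oo[)
    (beta_weight a u * expR (x * (1 - 2 * (1 + u)^-1))).
Proof.
move=> hrho x0 a; have a0 : 0 < a by rewrite subr_gt0.
have rE : a + 2^-1 = rho by rewrite /a; field.
have r0 : 0 < rho by rewrite -rE addr_gt0// invr_gt0.
have := cvg_double (cvg_series_beta_moment (x := x) a0).
set J := \int[mu]_(u in _) _ => cJ.
have W0 : beta_moment a 0 0 != 0.
  rewrite beta_moment0r// addr0 gt_eqF// divr_gt0 ?mulr_gt0 ?Gamma_gt0//.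
  by rewrite addr_gt0.
have G0 : Gamma rho != 0 by rewrite gt_eqF// Gamma_gt0.
(* Partial sums agree exactly: each step adds one vanishing odd term and one even term, which
   [beta_moment_even] turns into the Bessel term. *)
have sE n : (x / 2) `^ (rho - 1) *
    series (fun n => x ^+ n / n`!%:R * beta_moment a 0 n) n.*2 =
    Gamma rho * beta_moment a 0 0 * series (fun k : nat =>
    (x / 2) `^ (2 * k%:R + (rho - 1)) / (k`!%:R * Gamma (k%:R + 1 + (rho - 1)))) n.
  elim: n => [|n IH]; first by rewrite /series/= !big_geq// !mulr0.
  rewrite doubleS !seriesSr !mulrDr IH beta_moment_odd// !mulr0 addr0; congr (_ + _).
  have -> : n%:R + 1 + (rho - 1) = rho + n%:R by ring.
  have Gn : Gamma (rho + n%:R) != 0 by rewrite gt_eqF// Gamma_gt0// ltr_wpDr.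
  have f0 : n`!%:R != 0 :> R by rewrite pnatr_eq0 -lt0n fact_gt0.
  have f20 : n.*2`!%:R != 0 :> R by rewrite pnatr_eq0 -lt0n fact_gt0.
  have E := beta_moment_even n a0; rewrite rE in E.
  have -> : beta_moment a 0 n.*2 = Gamma rho * beta_moment a 0 0 * n.*2`!%:R /
      (4 ^+ n * n`!%:R * Gamma (rho + n%:R)).
    by rewrite -E; field; rewrite Gn f0 expf_neq0.
  rewrite (@powRD _ (x / 2) (2 * n%:R)); last first.
    by rewrite (gt_eqF (divr_gt0 x0 _)) ?implybT.
  rewrite powRrM powR_mulrn ?powR_ge0// powR_mulrn; last by rewrite divr_ge0 ?(ltW x0).
  have -> : ((x / 2) ^+ 2) ^+ n = x ^+ n.*2 / 4 ^+ n.
    by rewrite -exprM mul2n exprMn exprVn -mul2n [2 ^+ _]exprM -natrX.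
  by field; rewrite Gn f0 f20 expf_neq0.
have : Gamma rho * beta_moment a 0 0 * series (fun k : nat =>
    (x / 2) `^ (2 * k%:R + (rho - 1)) / (k`!%:R * Gamma (k%:R + 1 + (rho - 1)))) n
    @[n --> \oo] --> (x / 2) `^ (rho - 1) * J.
  under eq_fun do rewrite -sE.
  by apply: cvgM; [exact: cvg_cst|exact: cJ].
set S := series _ => cS.
(* [besselI] is defined by [limn], so its series must be shown to converge; dividing by the nonzero
   constant does this. *)
have cS' : S @ \oo --> (Gamma rho * beta_moment a 0 0)^-1 * ((x / 2) `^ (rho - 1) * J).
  have K0 : Gamma rho * beta_moment a 0 0 != 0 by rewrite mulf_neq0.
  rewrite (_ : S = (fun n => (Gamma rho * beta_moment a 0 0)^-1 *
    (Gamma rho * beta_moment a 0 0 * S n))); last first.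
    by apply/funext => n; rewrite mulKf.
  by apply: cvgM; [exact: cvg_cst|exact: cS].
rewrite /besselI -/S (cvg_lim _ cS')// mulVKf// mulf_neq0//.
Qed.

(** The exponentials combine to [exp(-2 B x)], and the powers of 2 and of [x] collapse to [1/x]. *)
Lemma besselI_integrandE (R : realType) (rho x : R) : 1 / 2 < rho -> 0 < x ->
  let a := rho - 1 / 2 in
  2 `^ (rho - 1) * Gamma rho * beta_moment a 0 0 *
    (expR (- x) * besselI (rho - 1) x / x `^ rho) =
  \int[mu]_(u in `]0%R, +oo[)
    (beta_weight a u * (x `^ (- 1) * expR (- (2 * (1 + u)^-1 * x)))).
Proof.
move=> hrho x0 a; have a0 : 0 < a by rewrite subr_gt0.
pose D : set (measurableTypeR R) := `]0%R, +oo[%classic.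
have mD : measurable D by exact: measurable_itv.
have mg : measurable_fun D (fun u : R => expR (x * (1 - 2 * (1 + u)^-1))).
  apply: measurableT_comp; first exact: measurable_expR.
  apply: measurable_funM => //.
  apply: measurable_funB => //; apply: measurable_funM => //.
  exact: measurable_inv1D.
have IJ : (@lebesgue_measure R).-integrable D
    (EFin \o (fun u => beta_weight a u * expR (x * (1 - 2 * (1 + u)^-1)))).
  have I0 := integrableZl mD (expR x) (betaprime_integrable a0 a0).
  apply: (le_integrable mD _ _ I0).
    apply/measurable_EFinP; apply: measurable_funM => //.
    exact: measurable_betaprime.
  move=> u; rewrite /D/= in_itv/= andbT => /inv1D_itv /andP[b0 b1].
  rewrite lee_fin !ger0_norm ?mulr_ge0 ?powR_ge0 ?expR_ge0// mulrC ler_wpM2r//.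
    by rewrite mulr_ge0 ?powR_ge0.
  rewrite ler_expR ler_piMr ?(ltW x0)//; lra.
have := besselIE hrho x0; rewrite -/a => B.
have -> : 2 `^ (rho - 1) * Gamma rho * beta_moment a 0 0 *
    (expR (- x) * besselI (rho - 1) x / x `^ rho) =
  x `^ (- 1) * expR (- x) * \int[mu]_(u in `]0%R, +oo[)
    (beta_weight a u * expR (x * (1 - 2 * (1 + u)^-1))).
  transitivity (2 `^ (rho - 1) * expR (- x) / x `^ rho *
    (Gamma rho * beta_moment a 0 0 * besselI (rho - 1) x)); first by ring.
  rewrite B powRM ?invr_ge0 ?(ltW x0)// -[2^-1]powR_inv1// -powRrM mulN1r powRN.
  have -> : x `^ rho = x `^ (rho - 1) * x.
    by rewrite -{3}(powRr1 (ltW x0)) -powRD ?subrK// (gt_eqF x0) implybT.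
  rewrite powR_inv1 ?(ltW x0)//; field.
  by rewrite !gt_eqF// powR_gt0.
rewrite -(RintegralZl _ mD IJ); apply: eq_Rintegral => u _.
transitivity (beta_weight a u * (x `^ (- 1) *
  (expR (- x) * expR (x * (1 - 2 * (1 + u)^-1))))); first by ring.
by rewrite -expRD; congr (_ * (_ * expR _)); ring.
Qed.

(** * The hypergeometric side *)

Lemma Gamma_nat1D (R : realType) (n : nat) : Gamma (1 + n%:R) = n`!%:R :> R.
Proof.
elim: n => [|n IH]; first by rewrite addr0 Gamma1 fact0.
have -> : 1 + n.+1%:R = 1 + n%:R + 1 :> R by ring.
by rewrite GammaDr1 ?ltr_wpDr// IH factS natrM nat1r.
Qed.

(** Each quotient of Pochhammer symbols of 1 and 2 is [1/(l+1)], and [Gamma (2 a + 1) / Gamma (a +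
    1) = 2 Gamma (2 a) / Gamma a] supplies the additional 2 in [(2 y)^(l+1)]. *)
Lemma hypergeometric3F3_termE (R : realType) (a y : R) (l : nat) : 0 < a ->
  y * ((pochhammer 1 l * pochhammer 1 l * pochhammer (a + 1) l) /
    (pochhammer 2 l * pochhammer 2 l * pochhammer (a + a + 1) l) *
    ((- 2 * y) ^+ l / l`!%:R)) * beta_moment a 0 0 =
  (- 1) ^+ l * (2 * y) ^+ l.+1 / (l.+1%:R * l.+1`!%:R) * beta_moment a l.+1 0.
Proof.
move=> a0; have aa0 : 0 < a + a by rewrite addr_gt0.
rewrite !(beta_moment0r _ a0) addr0 /pochhammer.
have -> : a + 1 + l%:R = a + l.+1%:R by ring.
have -> : a + a + 1 + l%:R = a + (a + l.+1%:R) by ring.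
have -> : 2 + l%:R = 1 + l.+1%:R :> R by ring.
rewrite !Gamma_nat1D Gamma1 (_ : Gamma 2 = 1); last exact: (Gamma_nat1D R 1).
rewrite (GammaDr1 a0) (GammaDr1 aa0) factS !natrM.
have n0 (x : R) : 0 < x -> x != 0 by move=> x0; rewrite gt_eqF.
have f0 : l`!%:R != 0 :> R by rewrite pnatr_eq0 -lt0n fact_gt0.
have g1 : Gamma a != 0 by rewrite n0// Gamma_gt0.
have g2 : Gamma (a + a) != 0 by rewrite n0// Gamma_gt0.
have g3 : Gamma (a + (a + l.+1%:R)) != 0.
  by rewrite n0// Gamma_gt0// addr_gt0// ltr_wpDr.
have l0 : l.+1%:R != 0 :> R by rewrite pnatr_eq0.
have -> : (- 2 * y) ^+ l = (- 1) ^+ l * (2 * y) ^+ l.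
  by rewrite -exprMn mulN1r mulNr.
rewrite exprS.
set p := (-1) ^+ l; set q := (2 * y) ^+ l.
set g4 := Gamma (a + l.+1%:R).
move: l0 f0 g3; set L := l.+1%:R; set F := l`!%:R; set g5 := Gamma _ => l0 f0 g3.
clearbody g4 g5; move: (Gamma a) (Gamma (a + a)) g1 g2 => ? ? g1 g2; field.
by rewrite g3 f0 g2 g1 nat1r pnatr_eq0 (n0 _ aa0) (n0 _ a0).
Qed.

Lemma measurable_besselI_kernel (R : realType) (a C y : R) :
  measurable_fun ((`]y, +oo[%classic : set R) `*` (`]0%R, +oo[%classic : set R))
    (fun z : R * R => C * (beta_weight a z.2 *
      (z.1 `^ (- 1) * expR (- (2 * (1 + z.2)^-1 * z.1))))).
Proof.
have mB : measurable (`]0%R, +oo[%classic : set R) by exact: measurable_itv.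
(* The functions of [u] are measurable on [u > 0], so composing them with the second projection
   requires that it map the rectangle into that half-line. *)
have snd_sub : @snd R R @` ((`]y, +oo[%classic : set R) `*` (`]0%R, +oo[%classic : set R))
    `<=` (`]0%R, +oo[%classic : set R) by move=> _ [[x u] [_ h] <-].
have m2 f : measurable_fun (`]0%R, +oo[%classic : set R) f ->
    measurable_fun ((`]y, +oo[%classic : set R) `*` (`]0%R, +oo[%classic : set R))
      (fun z : R * R => f z.2 : R).
  move=> mf; apply: (measurable_comp mB snd_sub mf).
  by apply: measurable_funTS; exact: measurable_snd.
apply: measurable_funM => //; apply: measurable_funM.
  by apply: (m2 (beta_weight a)); exact: measurable_betaprime.
apply: measurable_funM.
  apply: measurable_funTS.
  exact: measurableT_comp (measurable_powR _) measurable_fst.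
apply: measurableT_comp; first exact: measurable_expR.
apply: measurable_funN; apply: measurable_funM.
  apply: measurable_funM => //; apply: (m2 (fun u => (1 + u)^-1)).
  exact: measurable_inv1D.
by apply: measurable_funTS; exact: measurable_fst.
Qed.

(** [Q u] is Ein at [2 B y]; its expansion in powers of [B] is integrated term by term against the
    weight. *)
Lemma integral_beta_Ein (R : realType) (a y : R) : 0 < a -> 0 < y ->
  let Q u := \int[mu]_(x in `]0%R, y[)
      ((1 - expR (- (2 * (1 + u)^-1 * x))) * x `^ (- 1)) in
  (@lebesgue_measure R).-integrable `]0, +oo[ (EFin \o (fun u => beta_weight a u * Q u)) /\
  \int[mu]_(u in `]0%R, +oo[) (beta_weight a u * Q u) =
  y * hypergeometric3F3 1 1 (a + 1) 2 2 (a + a + 1) (- 2 * y) * beta_moment a 0 0.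
Proof.
move=> a0 y0 Q.
pose D : set (measurableTypeR R) := `]0%R, +oo[%classic.
have mD : measurable D by exact: measurable_itv.
pose c k : R := (- 1) ^+ k * (2 * y) ^+ k.+1 / (k.+1%:R * k.+1`!%:R).
have cc : cvgn (series (fun k => `|c k|)).
  apply: (@is_cvg_series_norm_le_exp _ 1 (2 * y)) => // k.
  rewrite /c !normrM normfV !normrX normrN1 expr1n !mul1r !normrM !normr_nat.
  rewrite ler_wpM2l ?exprn_ge0 ?mulr_ge0// lef_pV2 ?posrE ?mulr_gt0 ?ltr0n ?fact_gt0//.
  by rewrite -natrM ler_nat leq_pmull.
have g1 (u : R) : D u -> `|(1 + u)^-1| <= 1.
  rewrite /D/= in_itv/= andbT => /inv1D_itv /andP[b0 b1].
  by rewrite ger0_norm ltW.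
(* The expansion of [Q] starts at the first power of [B]. That factor is moved into the weight, so
   the series starts at exponent 0 and the moments carry the index [k + 1]. *)
have Iw : (@lebesgue_measure R).-integrable D
    (EFin \o (fun u => beta_weight a u * (1 + u)^-1)).
  apply: eq_integrable (beta_weight_moment_integrable 1 0 a0) => // u _ /=.
  by rewrite expr0 mulr1.
have [I c1] := Rintegral_power_series mD (@measurable_inv1D R) g1 Iw cc.
have QE (u : R) : D u -> beta_weight a u * (1 + u)^-1 *
    limn (series (fun k => c k * (1 + u)^-1 ^+ k)) = beta_weight a u * Q u.
  rewrite /D/= in_itv/= andbT => /inv1D_itv /andP[b0 b1].
  have b20 : 0 < 2 * (1 + u)^-1 by rewrite mulr_gt0.
  have cQ := cvg_series_Ein b20 y0; rewrite -/(Q u) in cQ.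
  rewrite -mulrA; congr (_ * _).
  have cv : series (fun k => c k * (1 + u)^-1 ^+ k) @ \oo --> (1 + u)^-1^-1 * Q u.
    rewrite (_ : series _ = (fun n => (1 + u)^-1^-1 *
      series (fun k => (- 1) ^+ k * (2 * (1 + u)^-1 * y) ^+ k.+1 /
        (k.+1%:R * k.+1`!%:R)) n)).
      by apply: cvgM; [exact: cvg_cst|exact: cQ].
    apply/funext => n; rewrite /series/= mulr_sumr; apply: eq_bigr => k _.
    rewrite /c [2 * _ * y]mulrAC [(_ * (1 + u)^-1) ^+ _]exprMn [(1 + u)^-1 ^+ k.+1]exprS.
    move: b0; set b := (1 + u)^-1 => b0.
    transitivity ((b^-1 * b) * ((-1) ^+ k * (2 * y) ^+ k.+1 / (k.+1%:R * (k.+1)`!%:R) * b ^+ k)).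
      by rewrite mulVf ?gt_eqF// mul1r.
    by ring.
  by rewrite (cvg_lim _ cv)// mulVKf// gt_eqF.
split.
  by apply: eq_integrable I => // u /set_mem Du /=; rewrite QE.
have {}c1 : series (fun k => c k * beta_moment a k.+1 0) @ \oo -->
    \int[mu]_(u in `]0%R, +oo[) (beta_weight a u * Q u).
  move: c1; rewrite (_ : (fun k => c k * _) = (fun k => c k * beta_moment a k.+1 0)).
    rewrite (_ : \int[mu]_(u in D) _ = \int[mu]_(u in `]0%R, +oo[) (beta_weight a u * Q u))//.
    by apply: eq_Rintegral => u /set_mem; exact: QE.
  apply/funext => k; congr (_ * _); apply: eq_Rintegral => u _.
  by rewrite expr0 mulr1 exprS mulrA.
move: c1; set J := \int[mu]_(u in _) _ => c1.
have W0 : beta_moment a 0 0 != 0.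
  rewrite beta_moment0r// addr0 gt_eqF// divr_gt0 ?mulr_gt0 ?Gamma_gt0//.
  by rewrite addr_gt0.
have yW0 : y * beta_moment a 0 0 != 0 by rewrite mulf_neq0// gt_eqF.
rewrite mulrAC /hypergeometric3F3.
set T := series (fun l : nat => pochhammer 1 l * _ * _ / _ * _).
suff cT : T @ \oo --> (y * beta_moment a 0 0)^-1 * J.
  by rewrite (cvg_lim _ cT)// mulVKf.
rewrite (_ : T = (fun n => (y * beta_moment a 0 0)^-1 *
    series (fun k => c k * beta_moment a k.+1 0) n)).
  by apply: cvgM; [exact: cvg_cst|exact: c1].
apply/funext => n; rewrite /T /series/= mulr_sumr; apply: eq_bigr => k _.
rewrite /c -hypergeometric3F3_termE//.
by rewrite -[LHS](mulKf yW0); congr (_ * _); exact: mulrAC.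
Qed.

Lemma integral_beta_expR_div (R : realType) (a y : R) : 0 < a -> 0 < y ->
  let q u := \int[mu]_(x in `]0%R, y[)
      ((1 - expR (- (2 * (1 + u)^-1 * x))) * x `^ (- 1))
     - euler_mascheroni - ln (2 * (1 + u)^-1) - ln y in
  (@lebesgue_measure R).-integrable `]0, +oo[ (EFin \o (fun u => beta_weight a u * q u)) /\
  \int[mu]_(u in `]0%R, +oo[) (beta_weight a u * q u) =
  beta_moment a 0 0 * (- euler_mascheroni
   + y * hypergeometric3F3 1 1 (a + 1) 2 2 (a + a + 1) (- 2 * y)
   - ln (2 * y) + digamma (a + a) - digamma a).
Proof.
move=> a0 y0 q.
pose D : set (measurableTypeR R) := `]0%R, +oo[%classic.
have mD : measurable D by exact: measurable_itv.
have [I1 E1] := integral_beta_Ein a0 y0.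
have [I2 E2] := integral_betaprime_ln a0 a0.
have I3 : (@lebesgue_measure R).-integrable D (EFin \o beta_weight a).
  exact: betaprime_integrable.
have I4 := integrableZl mD (- euler_mascheroni - ln (2 * y)) I3.
have I5 := integrableD mD I1 I4.
have I6 := integrableB mD I5 I2.
(* [ln (2 B) + ln y] is regrouped as [ln (2 y) + ln B], so that the only logarithm depending on [u]
   is [ln B], whose integral is known. *)
have E (u : R) : D u -> beta_weight a u * q u =
    beta_weight a u * (\int[mu]_(x in `]0%R, y[)
      ((1 - expR (- (2 * (1 + u)^-1 * x))) * x `^ (- 1))) +
    (- euler_mascheroni - ln (2 * y)) * beta_weight a u -
    u `^ (a - 1) * ((1 + u)^-1 `^ (a + a) * ln (1 + u)^-1).
  rewrite /D/= in_itv/= andbT => /inv1D_itv /andP[b0 b1].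
  by rewrite /q !lnM ?posrE// /beta_weight; ring.
split.
  by apply: eq_integrable I6 => // u /set_mem Du; rewrite /= E.
transitivity (\int[mu]_(u in D) (beta_weight a u * (\int[mu]_(x in `]0%R, y[)
      ((1 - expR (- (2 * (1 + u)^-1 * x))) * x `^ (- 1))) +
    (- euler_mascheroni - ln (2 * y)) * beta_weight a u -
    u `^ (a - 1) * ((1 + u)^-1 `^ (a + a) * ln (1 + u)^-1))).
  by apply: eq_Rintegral => u /set_mem; exact: E.
rewrite (RintegralB mD I5 I2) (RintegralD mD I1 I4) (RintegralZl _ mD I3).
rewrite E1 E2.
have -> : \int[mu]_(u in D) beta_weight a u = beta_moment a 0 0.
  by apply: eq_Rintegral => u _; rewrite !expr0 !mulr1.
rewrite -[Gamma a * Gamma a / Gamma (a + a)](_ : beta_moment a 0 0 = _); last first.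
  by rewrite (beta_moment0r _ a0) addr0.
move: (beta_moment a 0 0) (hypergeometric3F3 _ _ _ _ _ _ _) => *.
move: euler_mascheroni (digamma _) (digamma _) => *.
by ring.
Qed.

(** * Assembly: averaging the exponential integral over the beta law *)

Theorem lemma1 (R : realType) (rho y : R) (hrho : 1 / 2 < rho) (hy : 0 < y) :
  ((2 `^ (rho - 1) * Gamma rho)%:E *
     \int[lebesgue_measure]_(x in `]y, +oo[)
        (expR (- x) * besselI (rho - 1) x / x `^ rho)%:E)%E =
  (- euler_mascheroni
   + y * hypergeometric3F3 1 1 (rho + 1 / 2) 2 2 (2 * rho) (- 2 * y)
   - ln (2 * y)
   + digamma (2 * rho - 1) - digamma (rho - 1 / 2))%:E.
Proof.
pose a := rho - 1 / 2; have a0 : 0 < a by rewrite subr_gt0.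
have r0 : 0 < rho by have : 0 < a by []; rewrite /a; lra.
pose W := beta_moment a 0 0.
have W0 : 0 < W.
  rewrite /W beta_moment0r// addr0 divr_gt0 ?mulr_gt0 ?Gamma_gt0//.
  by rewrite addr_gt0.
pose K := 2 `^ (rho - 1) * Gamma rho.
have K0 : 0 < K by rewrite mulr_gt0 ?powR_gt0 ?Gamma_gt0.
(* [C] cancels both the prefactor [K] of the left-hand side and the total mass [W] of the weight. *)
pose C := (K * W)^-1; have C0 : 0 < C by rewrite invr_gt0 mulr_gt0.
pose f (x u : R) := C * (beta_weight a u *
      (x `^ (- 1) * expR (- (2 * (1 + u)^-1 * x)))).
pose D : set (measurableTypeR R) := `]0%R, +oo[%classic.
have mD : measurable D by exact: measurable_itv.
pose q (u : R) := \int[mu]_(x in `]0%R, y[)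
      ((1 - expR (- (2 * (1 + u)^-1 * x))) * x `^ (- 1))
     - euler_mascheroni - ln (2 * (1 + u)^-1) - ln y.
have [Iq Eq] := integral_beta_expR_div a0 hy.
have -> : (\int[lebesgue_measure]_(x in `]y, +oo[)
        (expR (- x) * besselI (rho - 1) x / x `^ rho)%:E =
   \int[mu]_(x in `]y, +oo[) \int[mu]_(u in `]0%R, +oo[) (f x u)%:E)%E.
  apply: eq_integral => x; rewrite inE/= in_itv/= andbT => yx.
  have x0 := lt_trans hy yx.
  have J := besselI_integrandE hrho x0; rewrite -/a -/W -/K in J.
  (* For fixed [x > y] the exponential is at most 1, so a multiple of the weight dominates;
     integrability lets the inner integral be read as a real number. *)
  have If : (@lebesgue_measure R).-integrable D (EFin \o f x).
    have I3 : (@lebesgue_measure R).-integrable D (EFin \o beta_weight a).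
      exact: betaprime_integrable.
    have I4 := integrableZl mD (C * x `^ (- 1)) I3.
    apply: (le_integrable mD _ _ I4).
      apply/measurable_EFinP.
      apply: measurable_funM => //; apply: measurable_funM.
        exact: measurable_betaprime.
      apply: measurable_funM => //.
      apply: measurableT_comp; first exact: measurable_expR.
      apply: measurable_funN; apply: measurable_funM => //.
      by apply: measurable_funM => //; exact: measurable_inv1D.
    move=> u; rewrite /D/= in_itv/= andbT => /inv1D_itv /andP[b0 b1].
    have w0 := beta_weight_ge0 a u; have p0 := powR_ge0 x (-1).
    have e0 := expR_ge0 (- (2 * (1 + u)^-1 * x)).
    have C0' := ltW C0.
    rewrite lee_fin /f !ger0_norm ?mulr_ge0 ?powR_ge0//.
    rewrite [leRHS](_ : _ = C * (beta_weight a u * (x `^ (- 1) * 1))); last by ring.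
    rewrite !ler_wpM2l//.
    rewrite -[leRHS]expR0 ler_expR oppr_le0 mulr_ge0 ?(ltW x0)//.
    by rewrite mulr_ge0 ?(ltW b0).
  have -> : (\int[mu]_(u in `]0%R, +oo[) (f x u)%:E =
      (\int[mu]_(u in `]0%R, +oo[) f x u)%:E)%E.
    by rewrite fineK//; exact: (integrable_fin_num mD If).
  congr EFin.
  have IJ : (@lebesgue_measure R).-integrable D (EFin \o (fun u =>
      beta_weight a u * (x `^ (- 1) * expR (- (2 * (1 + u)^-1 * x))))).
    have := integrableZl mD C^-1 If.
    by apply: eq_integrable => // u _; rewrite /= -EFinM mulKf// gt_eqF.
  rewrite /f (RintegralZl _ mD IJ) -J /C mulKf// mulf_neq0// gt_eqF//.
have mA : measurable (`]y, +oo[%classic : set R) by exact: measurable_itv.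
have mB : measurable (`]0%R, +oo[%classic : set R) by exact: measurable_itv.
rewrite (tonelli_on mA mB (@measurable_besselI_kernel R a C y)); last first.
  move=> x u _ _; rewrite !mulr_ge0 ?expR_ge0 ?powR_ge0 ?beta_weight_ge0//.
  exact: ltW.
(* After the exchange, the inner integral in [x] is the exponential integral with [c = 2 B]. *)
have -> : (\int[mu]_(u in `]0%R, +oo[) \int[mu]_(x in `]y, +oo[) (f x u)%:E =
    \int[mu]_(u in `]0%R, +oo[) (C%:E * (beta_weight a u * q u)%:E))%E.
  apply: eq_integral => u; rewrite inE/= in_itv/= andbT => u0.
  have /andP[b0 b1] := inv1D_itv u0.
  have b20 : 0 < 2 * (1 + u)^-1 by rewrite mulr_gt0.
  have := integral_expR_div b20 hy; rewrite -/(q u) => qE.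
  under eq_integral do rewrite /f [C * _]mulrA EFinM.
  rewrite ge0_integralZl_EFin//.
  - by rewrite qE -!EFinM; congr EFin; exact/esym/mulrA.
  - by move=> x _; rewrite lee_fin mulr_ge0 ?powR_ge0 ?expR_ge0.
  - apply/measurable_EFinP/measurable_funTS; apply: measurable_funM.
      exact: measurable_powR.
    apply: measurableT_comp; first exact: measurable_expR.
    by apply: measurable_funN; exact: measurable_funM.
  - by rewrite mulr_ge0 ?(ltW C0)// beta_weight_ge0.
rewrite (integralZl mD Iq).
rewrite -[X in (_ * (_ * X))%E](fineK (integrable_fin_num mD Iq)).
rewrite -[fine _]/(\int[mu]_(u in `]0%R, +oo[) (beta_weight a u * q u)) Eq.
rewrite -!EFinM; congr EFin.
(* Translation of the parameters back to [a]; in particular [2 rho - 1] becomes [a + a]. *)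
have -> : rho + 1 / 2 = a + 1 by rewrite /a; field.
have -> : 2 * rho = a + a + 1 by rewrite /a; field.
rewrite (addrK 1 (a + a)) -[rho - 1 / 2]/a.
have KC : K * (C * W) = 1.
  by rewrite /C mulrCA mulVf// mulf_neq0// lt0r_neq0.
by rewrite [C * _]mulrA [LHS]mulrA KC mul1r.
Qed.
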